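(* Let $\mathcal{I}:I\to\mathbb{R}$ be a $d$-dimensional grayscale digital image, $N>\max_{p\in I}\mathcal{I}(p)$, and $\mathcal{I}^{\mathbf P}:I^{\mathbf P}\to\mathbb{R}$ the image padded with the value $N$. Then: 1. $\mathsf{Dgm}(V(\mathcal{I}^{\mathbf P}))=\mathsf{Dgm}(V(\mathcal{I}))$ and $\mathsf{Dgm}(T(\mathcal{I}^{\mathbf P}))=\mathsf{Dgm}(T(\mathcal{I}))$. 2. $$\mathsf{Dgm}(\widehat{V}(\mathcal{I}^{\mathbf P}))=\mathsf{Dgm}(V(\mathcal{I}^{\mathbf P}))\cup\{\,[N,\infty)_d\,\}$$ and $$\mathsf{Dgm}(\widehat{T}(\mathcal{I}))=\mathsf{Dgm}(T(\mathcal{I}))\cup\{\,[N,\infty)_d\,\}.$$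
   Context: Images: a $d$-dimensional grayscale digital image ($d\ge1$) is a function $\mathcal{I}:I\to\mathbb{R}$, $I=\{1,\dots,n_1\}\times\dots\times\{1,\dots,n_d\}$. The padded image $\mathcal{I}^{\mathbf P}$ has domain $I^{\mathbf P}=\{0,\dots,n_1+1\}\times\dots\times\{0,\dots,n_d+1\}$, equals $\mathcal{I}$ on $I$ and equals $N$ on $I^{\mathbf P}\setminus I$. V-construction: for an image $\mathcal{J}:J\to\mathbb{R}$ on a grid $J$ of size $(m_1,\dots,m_d)$, $V(J)$ is the cubical complex of the array of $(m_1-1)\times\dots\times(m_d-1)$ unit $d$-cubes and all their faces, with vertices indexed exactly by $J$ (the unit-cube subdivision of the box spanned by $J$); $V(\mathcal{J})$ equals $\mathcal{J}(p)$ on the vertex indexed by $p$ and on a cube is the maximum of the values on its vertices. T-construction: $T(J)$ is the cubical complex of the array of $m_1\times\dots\times m_d$ unit $d$-cubes and all their faces, with $d$-cubes indexed exactly by $J$ (the cube of $p$ being, up to translation, $\prod_i[p_i-\frac12,p_i+\frac12]$); $T(\mathcal{J})$ equals $\mathcal{J}(p)$ on the $d$-cube indexed by $p$ and on a cube $\sigma$ is the minimum of the values on the $d$-cubes containing $\sigma$ as a face. For $Y=T(I)$ or $Y=V(I^{\mathbf P})$, $\partial Y$ is the boundary of the underlying box and $Y\sqcup_{\partial Y}\kappa^{(d)}$ is obtained by attaching one $d$-cell $\kappa^{(d)}$ along $\partial Y$ (by a homeomorphism from the boundary sphere of the $d$-ball onto $\partial Y$). The functions $\widehat{T}(\mathcal{I})$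 on $T(I)\sqcup_{\partial T(I)}\kappa^{(d)}$ and $\widehat{V}(\mathcal{I}^{\mathbf P})$ on $V(I^{\mathbf P})\sqcup_{\partial V(I^{\mathbf P})}\kappa^{(d)}$ extend $T(\mathcal{I})$, respectively $V(\mathcal{I}^{\mathbf P})$, by the value $N$ on $\kappa^{(d)}$. Persistence diagrams: for a function $f:X\to\mathbb{R}$ on the cells of a finite cell complex with $f(\sigma)\le f(\tau)$ whenever $\sigma$ is a face of $\tau$, the functor $H_k(f):r\mapsto H_k(f^{-1}(-\infty,r];\mathbb{Z}/2\mathbb{Z})$ on the poset $(\mathbb{R},\le)$ decomposes as a direct sum of interval modules $\mathbb{I}_{[b_l,d_l)}$ ($\mathbb{Z}/2\mathbb{Z}$ on $[b_l,d_l)$ with identity maps, $0$ elsewhere), $d_l\in\mathbb{R}\cup\{\infty\}$. $\mathsf{Dgm}^k(f)$ is the resulting multiset of intervals, written $[b_l,d_l)_k$ to record the degree, and $\mathsf{Dgm}(f)=\bigsqcup_k\mathsf{Dgm}^k(f)$. Empty intervals are neglected; $\cup$ is multiset union (adding one copy). *)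

(* Defs.v *)
From HB Require Import structures.
From mathcomp Require Import all_boot all_order all_algebra.
From mathcomp Require Import generic_quotient ring_quotient.
From mathcomp Require Import finmap multiset.
From mathcomp Require Import boolp classical_sets reals constructive_ereal.

Set Implicit Arguments.
Unset Strict Implicit.
Unset Printing Implicit Defensive.

Import Order.TTheory GRing.Theory Num.Theory.
Local Open Scope mset_scope.
Local Open Scope ring_scope.

Section VQuot.
Variables (K : fieldType) (vT : vectType K) (U : {vspace vT}).

Definition vquot : Type := Quotient.quot (pred_of_vspace U).

HB.instance Definition _ := GRing.Zmodule.on vquot.

Definition vpi (x : vT) : vquot := \pi_(Quotient.quot (pred_of_vspace U))%qT x.

Lemma vpi_eq x y : (vpi x == vpi y) = (x - y \in U).
Proof. by rewrite -[RHS]/((x - y) \in pred_of_vspace U) Quotient.idealrBE. Qed.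

Lemma vpiP x y : x - y \in U -> vpi x = vpi y.
Proof. by rewrite -vpi_eq => /eqP. Qed.

Lemma vpiD x y : vpi (x + y) = vpi x + vpi y.
Proof. exact: (raddfD \pi_(Quotient.quot (pred_of_vspace U))%qT). Qed.

Lemma vpi_repr (z : vquot) : vpi (repr z) = z.
Proof. exact: reprK. Qed.

Lemma repr_vpi x : repr (vpi x) - x \in U.
Proof. by rewrite -vpi_eq vpi_repr. Qed.

Definition vquot_scale (a : K) (z : vquot) : vquot := vpi (a *: repr z).

Lemma vquot_scaleE a x : vquot_scale a (vpi x) = vpi (a *: x).
Proof. by apply: vpiP; rewrite -scalerBr memvZ // repr_vpi. Qed.

Lemma vquot_scaleA a b z :
  vquot_scale a (vquot_scale b z) = vquot_scale (a * b) z.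
Proof. by rewrite -[z]vpi_repr !vquot_scaleE scalerA. Qed.

Lemma vquot_scale1 : left_id 1 vquot_scale.
Proof. by move=> z; rewrite -[z]vpi_repr vquot_scaleE scale1r. Qed.

Lemma vquot_scaleDr : right_distributive vquot_scale +%R.
Proof.
move=> a y z; rewrite -[y]vpi_repr -[z]vpi_repr.
by rewrite -vpiD !vquot_scaleE scalerDr vpiD.
Qed.

Lemma vquot_scaleDl z : {morph vquot_scale^~ z : a b / a + b}.
Proof.
move=> a b /=; rewrite -[z]vpi_repr.
by rewrite !vquot_scaleE scalerDl vpiD.
Qed.

HB.instance Definition _ := GRing.Zmodule_isLmodule.Build K vquot
  vquot_scaleA vquot_scale1 vquot_scaleDr vquot_scaleDl.

Lemma vpi_linear : linear vpi.
Proof. by move=> a x y; rewrite vpiD -vquot_scaleE. Qed.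

HB.instance Definition _ := GRing.isLinear.Build K vT vquot _ vpi vpi_linear.

End VQuot.

Record persmod (R : realType) := PersMod {
  pobj :> R -> lmodType 'F_2;
  pmap : forall r s, r <= s -> {linear pobj r -> pobj s};
  pmap_id : forall r (h : r <= r) x, pmap h x = x;
  pmap_comp : forall r s t (rs : r <= s) (st : s <= t) (rt : r <= t) x,
    pmap st (pmap rs x) = pmap rt x }.

(* [(b, e)] stands for the half-open interval [b, e). *)
Definition bar (R : realType) := (R * \bar R)%type.

Section IntervalModule.
Variables (R : realType) (I : bar R).

Definition in_bar (r : R) : bool := (I.1 <= r) && (r%:E < I.2)%E.

Definition interval_space (r : R) : {vspace ('F_2)^o} :=
  if in_bar r then fullv else 0%VS.

(* [vsproj] is the identity when both spaces are 'F_2, and is 0 otherwise. *)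
Definition interval_map (r s : R) (x : subvs_of (interval_space r)) :
    subvs_of (interval_space s) :=
  vsproj (interval_space s) (vsval x).

Lemma interval_map_linear r s : linear (@interval_map r s).
Proof. by move=> a x y; rewrite /interval_map !linearP. Qed.

HB.instance Definition _ r s := GRing.isLinear.Build _ _ _ _ (@interval_map r s)
  (@interval_map_linear r s).

Lemma interval_map_id r (h : r <= r) x : @interval_map r r x = x.
Proof. exact: vsvalK. Qed.

Lemma interval_map_comp r s t (rs : r <= s) (st : s <= t) (rt : r <= t) x :
  @interval_map s t (@interval_map r s x) = @interval_map r t x.
Proof.
rewrite /interval_map; have [xs|xs] := boolP (vsval x \in interval_space s).
  by rewrite (vsprojK xs).
have x0 : vsval x != 0 by apply: contraNneq xs => ->; rewrite mem0v.
have rI : in_bar r.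
  apply: contraNT x0 => rI; have := subvsP x.
  by rewrite {2}/interval_space (negbTE rI) memv0.
have sI : ~~ in_bar s.
  by apply: contraNN xs => sI; rewrite /interval_space sI memvf.
have tI : ~~ in_bar t.
  apply: contraNN sI => /andP[_ tI]; case/andP: rI => rI _.
  by rewrite /in_bar (le_trans rI rs) (le_lt_trans _ tI) // lee_fin.
have z0 (y : subvs_of (interval_space t)) : y = 0.
  apply: val_inj; apply/eqP; have := subvsP y.
  by rewrite {2}/interval_space (negbTE tI) memv0.
by rewrite [LHS]z0 [RHS]z0.
Qed.

Definition interval_module : persmod R :=
  @PersMod R (fun r => subvs_of (interval_space r))
    (fun r s _ => @interval_map r s) interval_map_id interval_map_comp.

End IntervalModule.

Definition natural (R : realType) (M N : persmod R)
    (phi : forall r, {linear M r -> N r}) : Prop :=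
  forall r s (rs : r <= s) x, phi s (pmap M rs x) = pmap N rs (phi r x).

(* M is isomorphic to the direct sum of the interval modules of the members of
   D: a morphism out of the direct sum is a family of morphisms iota l, and it
   is an isomorphism when (x_l)_l |-> \sum_l iota_l x_l is bijective at each r.
   Empty intervals are excluded. *)
Definition decomposes (R : realType) (M : persmod R) (D : {mset bar R}) : Prop :=
  let I (l : 'I_(size (enum_mset D))) :=
    interval_module (tnth (in_tuple (enum_mset D)) l) in
  (forall J, J \in D -> (J.1%:E < J.2)%E) /\
  exists2 iota : forall l r, {linear I l r -> M r},
    forall l, natural (iota l) &
    forall r, bijective
      (fun x : {dffun forall l, I l r} => \sum_l iota l r (x l)).

(* The multiset D such that M decomposes along D. Persistence modules of finite
   complexes have exactly one; the value is irrelevant when there is none. *)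
Definition barcode (R : realType) (M : persmod R) : {mset bar R} :=
  xget mset0 [set D | decomposes M D]%classic.

(* [face s t] : s is a (not necessarily proper) face of t. This records the face
   poset of a finite regular cell complex; [fval] is monotone along faces, so
   that sublevel sets are subcomplexes, in all the instances below whose cap
   value is at least the values on the boundary. *)
Record filtered_complex (R : realType) := FilteredComplex {
  cell : finType;
  cdim : cell -> nat;
  face : rel cell;
  fval : cell -> R }.

Section Homology.
Variables (R : realType) (X : filtered_complex R).

Definition chain := {ffun cell X -> ('F_2)^o}.

(* In a regular cell complex the incidence numbers of codimension one faces
   are 1 or -1, hence 1 modulo 2. *)
Definition bd (c : chain) : chain :=
  [ffun s => \sum_(t | face s t && (cdim t == (cdim s).+1)) c t].

Lemma bd_linear : linear bd.
Proof.
move=> a x y; apply/ffunP => s; rewrite !ffunE scaler_sumr -big_split /=.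
by apply: eq_bigr => t _; rewrite !ffunE.
Qed.

HB.instance Definition _ := GRing.isLinear.Build _ _ _ _ bd bd_linear.

Definition cell_chain (s : cell X) : chain := [ffun t => (t == s)%:R].

Implicit Types (k : nat) (A B : {set cell X}).

Definition chains k A : {vspace chain} :=
  <<[seq cell_chain s | s <- enum [set s in A | cdim s == k]]>>%VS.

Definition cycles k A : {vspace chain} := (chains k A :&: lker (linfun bd))%VS.

Definition boundaries k A : {vspace chain} := (linfun bd @: chains k.+1 A)%VS.

(* Vectors of the subspace [cycles k A] that are boundaries. When A is closed
   under faces every boundary is a cycle, so [homology k A] below is Z_k / B_k. *)
Definition bd_in_cycles k A : {vspace subvs_of (cycles k A)} :=
  (linfun vsval @^-1: boundaries k A)%VS.

Definition homology k A : lmodType 'F_2 := vquot (bd_in_cycles k A).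

Lemma chainsS k A B : A \subset B -> (chains k A <= chains k B)%VS.
Proof.
move=> AB; apply: sub_span => c /mapP[s sA ->]; apply: map_f.
by move: sA; rewrite !mem_enum !inE => /andP[/(fintype.subsetP AB) -> ->].
Qed.

Lemma cyclesS k A B : A \subset B -> (cycles k A <= cycles k B)%VS.
Proof. by move=> AB; apply: capvS (chainsS k AB) (subvv _). Qed.

Lemma boundariesS k A B : A \subset B -> (boundaries k A <= boundaries k B)%VS.
Proof. by move=> AB; apply/limgS/chainsS. Qed.

Definition cycle_incl k A B (z : subvs_of (cycles k A)) :
  subvs_of (cycles k B) := vsproj (cycles k B) (vsval z).

(* The map [z] |-> [z] induced by an inclusion A \subset B. *)
Definition homology_map k A B (z : homology k A) : homology k B :=
  vpi (bd_in_cycles k B) (cycle_incl B (repr z)).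

Lemma cycle_inclE k A B (z : subvs_of (cycles k A)) :
  A \subset B -> vsval (cycle_incl B z) = vsval z.
Proof.
by move=> AB; apply: vsprojK; apply: (subvP (cyclesS k AB)); apply: subvsP.
Qed.

Lemma mem_bd_in_cycles k A z :
  (z \in bd_in_cycles k A) = (vsval z \in boundaries k A).
Proof. by rewrite -memv_preim lfunE. Qed.

Lemma homology_mapE k A B (z : subvs_of (cycles k A)) : A \subset B ->
  homology_map B (vpi (bd_in_cycles k A) z) =
  vpi (bd_in_cycles k B) (cycle_incl B z).
Proof.
move=> AB; apply: vpiP; rewrite mem_bd_in_cycles linearB /= !cycle_inclE //.
apply: (subvP (boundariesS k AB)); rewrite -linearB -mem_bd_in_cycles.
exact: repr_vpi.
Qed.

Lemma homology_map_linear k A B : A \subset B -> linear (@homology_map k A B).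
Proof.
move=> AB a x y; rewrite -[x]vpi_repr -[y]vpi_repr -linearP !homology_mapE //.
by rewrite -linearP; congr vpi; rewrite /cycle_incl !linearP.
Qed.

Definition homology_lin k A B (AB : A \subset B) :
    {linear homology k A -> homology k B} :=
  HB.pack_for {linear homology k A -> homology k B} (@homology_map k A B)
    (GRing.isLinear.Build _ _ _ _ (@homology_map k A B)
       (homology_map_linear (k := k) AB)).

Definition sublevel (r : R) : {set cell X} := [set s | fval s <= r].

Lemma sublevelS r s : r <= s -> sublevel r \subset sublevel s.
Proof.
by move=> rs; apply/fintype.subsetP => x; rewrite !inE => /le_trans; apply.
Qed.

Lemma homology_lin_id k r (h : r <= r) (x : homology k (sublevel r)) :
  homology_lin k (sublevelS h) x = x.
Proof.
rewrite -[in RHS](vpi_repr x) -[in LHS](vpi_repr x) /= homology_mapE //.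
by congr vpi; apply: val_inj; rewrite /= cycle_inclE.
Qed.

Lemma homology_lin_comp k r s t (rs : r <= s) (st : s <= t) (rt : r <= t)
    (x : homology k (sublevel r)) :
  homology_lin k (sublevelS st) (homology_lin k (sublevelS rs) x) =
  homology_lin k (sublevelS rt) x.
Proof.
have rsS := sublevelS rs; have stS := sublevelS st; have rtS := sublevelS rt.
rewrite -(vpi_repr x) /= !homology_mapE //.
by congr vpi; apply: val_inj; rewrite /= !cycle_inclE.
Qed.

Definition pers_homology k : persmod R :=
  @PersMod R (fun r => homology k (sublevel r))
    (fun r s rs => homology_lin k (sublevelS rs))
    (@homology_lin_id k) (@homology_lin_comp k).

Definition Dgm_deg k : {mset bar R} := barcode (pers_homology k).

Definition complex_dim : nat := \max_(s : cell X) cdim s.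

(* The pair [(k, (b, e))] stands for the interval [b, e) in degree k. There are
   no chains above the dimension of the complex. *)
Definition Dgm : {mset nat * bar R} :=
  seq_mset [seq (k, J) | k <- iota 0 complex_dim.+1, J <- enum_mset (Dgm_deg k)].

End Homology.

Section Images.
Variables (R : realType) (d : nat).
Implicit Types (n m : 'I_d -> nat).

(* Pixel coordinates start at 0. *)
Definition grid n := {dffun forall i : 'I_d, 'I_(n i)}.

Definition digital_image n := grid n -> R.

Definition padded_size n : 'I_d -> nat := fun i => (n i).+2.

(* Pixel q of the image is pixel q + (1, ..., 1) of the padded image. *)
Definition pad n (N : R) (I : digital_image n) : digital_image (padded_size n) :=
  fun p => if [pick q : grid n | [forall i, (q i).+1 == p i :> nat]] is Some q
           then I q else N.

(* A cube is a product of elementary intervals. The elementary intervals of a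
   subdivided segment are numbered from left to right: 2j is the j-th vertex
   {j}, and 2j+1 is the unit edge [j, j+1]. *)
Definition elem_face (a b : nat) : bool :=
  (a == b) || odd b && ((a.+1 == b) || (a == b.+1)).

(* [w i] is the number of elementary intervals in direction i. *)
Definition cube (w : 'I_d -> nat) := {dffun forall i : 'I_d, 'I_(w i)}.

Definition cube_dim w (s : cube w) : nat := #|[set i | odd (s i)]|.

Definition cube_face w : rel (cube w) :=
  fun s t => [forall i, elem_face (s i) (t i)].

Definition max_over (S : finType) (P : pred S) (F : S -> R) : R :=
  if [pick x | P x] is Some x0 then \big[Num.max/F x0]_(x | P x) F x else 0.

Definition min_over (S : finType) (P : pred S) (F : S -> R) : R :=
  if [pick x | P x] is Some x0 then \big[Num.min/F x0]_(x | P x) F x else 0.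

Definition cubical w (f : cube w -> R) : filtered_complex R :=
  FilteredComplex (@cube_dim w) (@cube_face w) f.

(* In each direction, n i vertices and n i - 1 edges; pixel p is the vertex
   with coordinates 2 p i. *)
Definition V_width n : 'I_d -> nat := fun i => (n i).*2.-1.

Definition V_val n (J : digital_image n) (s : cube (V_width n)) : R :=
  max_over [pred p : grid n | [forall i, elem_face (p i).*2 (s i)]] J.

Definition V n (J : digital_image n) : filtered_complex R := cubical (V_val J).

(* In each direction, n i edges and n i + 1 vertices; pixel p is the d-cube
   with coordinates 2 p i + 1. *)
Definition T_width n : 'I_d -> nat := fun i => (n i).*2.+1.

Definition T_val n (J : digital_image n) (s : cube (T_width n)) : R :=
  min_over [pred p : grid n | [forall i, elem_face (s i) (p i).*2.+1]] J.

Definition T n (J : digital_image n) : filtered_complex R := cubical (T_val J).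

Definition on_boundary w (s : cube w) : bool :=
  [exists i, (s i == 0 :> nat) || (s i == (w i).-1 :> nat)].

(* [None] is the attached d-cell: the attaching map is a homeomorphism onto the
   boundary of the box, so its proper faces are the cubes of that boundary. *)
Definition cap_dim w (s : option (cube w)) : nat :=
  if s is Some s' then cube_dim s' else d.

Definition cap_face w : rel (option (cube w)) := fun s t =>
  match s, t with
  | Some s', Some t' => cube_face s' t'
  | Some s', None => on_boundary s'
  | None, Some _ => false
  | None, None => true
  end.

Definition cap_val w (N : R) (f : cube w -> R) (s : option (cube w)) : R :=
  if s is Some s' then f s' else N.

Definition cap w (N : R) (f : cube w -> R) : filtered_complex R :=
  FilteredComplex (@cap_dim w) (@cap_face w) (cap_val N f).

Definition Vhat n (N : R) (J : digital_image n) : filtered_complex R :=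
  cap N (V_val J).

Definition That n (N : R) (J : digital_image n) : filtered_complex R :=
  cap N (T_val J).

End Images.

(* Main.v *)
(* Over F_2 a box is contractible: in each direction the segment has the
   contraction H sending a vertex to the sum of the edges on its left, with
   D H + H D = 1 + P, and applying these one direction at a time moves every
   cycle to the corner. Hence H_k of a box is 0 for k > 0 and is detected by the
   augmentation for k = 0, and a box of dimension d > 0 has no nonzero d-cycle.

   Padding embeds each complex in the larger one by shifting every coordinate by
   2. Below level N the sublevel sets coincide; from level N on both are full
   boxes. So the embedding induces isomorphisms on persistent homology.

   Attaching the cap changes nothing in degrees < d, since its boundary is
   already the boundary of the sum of all d-cubes. In degree d the box has no
   nonzero cycle, and the only nonzero cycle of the capped box is the sum of all
   d-cells, born at N. The only barcode of such a module is [N, oo), so neither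
   existence nor uniqueness of interval decompositions is needed in general. *)

From HB Require Import structures.
Require Import Defs.
From mathcomp Require Import all_boot all_order all_algebra.
From mathcomp Require Import finmap multiset.
From mathcomp Require Import boolp reals constructive_ereal.
From mathcomp Require classical_sets.
From mathcomp Require Import zify.

Set Implicit Arguments.
Unset Strict Implicit.
Unset Printing Implicit Defensive.

Import Order.TTheory GRing.Theory Num.Theory.
Local Open Scope mset_scope.
Local Open Scope ring_scope.

(** * Interval decompositions *)

Lemma addF2 (x : 'F_2) : x + x = 0.
Proof. by rewrite addrr_pchar2 // pchar_Fp. Qed.

Lemma F2_neq0 (x : 'F_2) : x != 0 -> x = 1.
Proof. by case: x => -[|[|]] // i; last (move=> _; apply: val_inj). Qed.

Section PersistenceModules.
Variable R : realType.
Implicit Types (M N : persmod R) (D : {mset bar R}).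

Lemma decomposes_bij M N (phi : forall r, {linear M r -> N r}) D :
  natural phi -> (forall r, bijective (phi r)) -> decomposes M D ->
  decomposes N D.
Proof.
move=> phiN phiB [D0 [iota iotaN iotaB]]; split=> //.
exists (fun l r => phi r \o iota l r) => [l r s rs x|r] /=.
  by rewrite iotaN phiN.
apply: (eq_bij (bij_comp (phiB r) (iotaB r))) => x /=.
by rewrite linear_sum.
Qed.

(** [barcode] is chosen from the set of all decompositions, so it suffices that the two modules have
    the same set. Decompositions are carried back along the inverse maps, which are again linear and
    natural. *)
Lemma barcode_bij M N (phi : forall r, {linear M r -> N r}) :
  natural phi -> (forall r, bijective (phi r)) -> barcode M = barcode N.
Proof.
move=> phiN phiB.
have /all_sig[psi psiP] (r : R) :
    {psi : {linear N r -> M r} | cancel (phi r) psi /\ cancel psi (phi r)}.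
  have /cid[g [phiK gK]] : exists g, cancel (phi r) g /\ cancel g (phi r).
    by case: (phiB r) => g ? ?; exists g.
  have g_lin : linear g by apply: can2_linear phiK gK.
  pose gL := HB.pack_for {linear N r -> M r} g
    (GRing.isLinear.Build _ _ _ _ g g_lin).
  by exists gL.
congr classical_sets.xget; apply/funext => D; apply/propext; split.
  exact: decomposes_bij phiN phiB.
apply: (decomposes_bij (phi := psi)) => [r s rs x|r].
  by rewrite -[RHS](psiP s).1 phiN (psiP r).2.
by exists (phi r); case: (psiP r).
Qed.

Section Bars.
Variables (J : bar R) (r : R).

Lemma mem_interval v : in_bar J r -> v \in interval_space J r.
Proof. by move=> Jr; rewrite /interval_space Jr memvf. Qed.

(** A generator when [r] lies in the bar. Outside the bar the space is zero and [vsproj] returns its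
    only element. *)
Definition bar_gen : interval_module J r := vsproj (interval_space J r) 1.

Lemma bar_genE : in_bar J r -> vsval bar_gen = 1.
Proof. by move=> Jr; rewrite vsprojK // mem_interval. Qed.

Lemma bar_gen_neq0 : in_bar J r -> bar_gen != 0.
Proof.
move=> Jr; apply/eqP => /(congr1 vsval) /=.
by rewrite bar_genE // => /eqP; rewrite oner_eq0.
Qed.

Lemma out_bar0 (x : interval_module J r) : ~~ in_bar J r -> x = 0.
Proof.
move=> Jr; apply: val_inj; apply/eqP; have := subvsP x.
by rewrite {2}/interval_space (negbTE Jr) memv0.
Qed.

End Bars.

Lemma decomposes0 M : (forall r (x : M r), x = 0) -> decomposes M mset0.
Proof.
move=> M0; split=> [J|]; first by rewrite in_mset0.
have n0 : size (enum_mset (mset0 : {mset bar R})) = 0%N by rewrite enum_mset0.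
have noI (l : 'I_(size (enum_mset (mset0 : {mset bar R})))) : False.
  by case: l => l; rewrite n0.
exists (fun l => False_rect _ (noI l)) => [l|r]; first by case: (noI l).
exists (fun=> [ffun l => False_rect _ (noI l)]) => x; last first.
  exact: etrans (M0 _ _) (esym (M0 _ x)).
by apply/ffunP => l; case: (noI l).
Qed.

Section Decomposition.
Variables (M : persmod R) (n : nat) (J : 'I_n -> bar R).
Variable iota : forall l r, {linear interval_module (J l) r -> M r}.
Hypothesis iotaN : forall l, natural (iota l).
Hypothesis iotaB : forall r, bijective
  (fun x : {dffun forall l, interval_module (J l) r} => \sum_l iota l r (x l)).

Definition bar_elt l r : M r := iota l r (bar_gen (J l) r).

Let single l r : {dffun forall l', interval_module (J l') r} :=
  [ffun l' => if l' == l then bar_gen (J l') r else 0].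

Let sum_single l r : \sum_l' iota l' r (single l r l') = bar_elt l r.
Proof.
rewrite (bigD1 l) //= big1 ?addr0 => [|l' /negPf ll']; rewrite ffunE.
  by rewrite eqxx.
by rewrite ll' linear0.
Qed.

Lemma bar_elt_neq0 l r : in_bar (J l) r -> bar_elt l r != 0.
Proof.
move=> Jr; apply: contraTneq isT => e0.
have : single l r = [ffun=> 0].
  apply: (bij_inj (iotaB r)); rewrite sum_single e0 big1 // => l' _.
  by rewrite ffunE linear0.
move/ffunP/(_ l); rewrite !ffunE eqxx => /eqP.
by rewrite (negPf (bar_gen_neq0 Jr)).
Qed.

Lemma bar_elt_inj l l' r : in_bar (J l) r -> bar_elt l r = bar_elt l' r -> l = l'.
Proof.
move=> Jr; rewrite -!sum_single => /(bij_inj (iotaB r)) /ffunP /(_ l).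
rewrite !ffunE eqxx; case: eqP => // _ /eqP.
by rewrite (negPf (bar_gen_neq0 Jr)).
Qed.

Lemma bar_elt_dies l r s (rs : r <= s) :
  ~~ in_bar (J l) s -> Defs.pmap M rs (bar_elt l r) = 0.
Proof. by move=> Js; rewrite -iotaN [X in iota l s X]out_bar0 // linear0. Qed.

Lemma alive_bar r (x : M r) : x != 0 -> exists l, in_bar (J l) r.
Proof.
case: (iotaB r) => g _ gK; rewrite -(gK x) => x0; apply/existsP.
apply: contraNT x0 => /existsPn noJ; rewrite big1 // => l _.
by rewrite [X in iota l r X]out_bar0 ?noJ ?linear0.
Qed.

End Decomposition.

Lemma bar_start (J : bar R) : (J.1%:E < J.2)%E -> in_bar J J.1.
Proof. by move=> J12; rewrite /in_bar lexx. Qed.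

Lemma barcode0 M : (forall r (x : M r), x = 0) -> barcode M = mset0.
Proof.
move=> M0; apply: classical_sets.xget_unique; first exact: decomposes0.
move=> D [Dne [iota _ iotaB]]; apply/eqP; apply: contraT => D0.
case: (posnP (size (enum_mset D))) => [/size0nil Dnil|n_gt0].
  by move: D0; rewrite -[D]seq_mset_id Dnil -enum_mset0 seq_mset_id eqxx.
pose l := Ordinal n_gt0; have JD := mem_tnth l (in_tuple (enum_mset D)).
have := bar_elt_neq0 iotaB (bar_start (Dne _ JD)).
by rewrite [bar_elt _ _ _]M0 eqxx.
Qed.

Lemma inj_surj_bij (S T : Type) (f : S -> T) :
  injective f -> (forall y, exists x, f x = y) -> bijective f.
Proof.
move=> f_inj f_surj; exists (fun y => sval (cid (f_surj y))) => [x|y].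
  by apply: f_inj; case: cid.
by case: cid.
Qed.

(** * Modules that are zero before [b] and one-dimensional from [b] on *)

Section Ray.
Variables (M : persmod R) (b : R) (g : forall r, M r).
Hypothesis before_b : forall r (x : M r), r < b -> x = 0.
Hypothesis g_neq0 : forall r, b <= r -> g r != 0.
Hypothesis g_gen : forall r (x : M r), b <= r -> x = 0 \/ x = g r.
Hypothesis g_map : forall r s (rs : r <= s), b <= r -> Defs.pmap M rs (g r) = g s.

Let ray : bar R := (b, +oo%E).

Let in_ray r : in_bar ray r = (b <= r).
Proof. by rewrite /in_bar ltry andbT. Qed.

Lemma decomposes_ray : decomposes M [mset ray].
Proof.
split=> [J|]; first by rewrite in_mset1 => /eqP -> /=; rewrite ltry.
rewrite (enum_msetn 1 ray) /=.
have in_t (l : 'I_1) r : in_bar (tnth (in_tuple [:: ray]) l) r = (b <= r).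
  by rewrite (ord1 l) in_ray.
pose f l r (x : interval_module (tnth (in_tuple [:: ray]) l) r) : M r :=
  (vsval x : 'F_2) *: (if b <= r then g r else 0).
have f_lin l r : linear (@f l r).
  by move=> a x y; rewrite /f linearP scalerDl scalerA.
pose fL l r := HB.pack_for {linear _ -> M r} (@f l r)
  (GRing.isLinear.Build _ _ _ _ (@f l r) (@f_lin l r)).
exists fL => [l r s rs x|r] /=.
  rewrite /f /=; case: (leP b r) => br; last first.
    rewrite (out_bar0 x) ?in_t -?ltNge //.
    by rewrite [interval_map s 0]linear0 scale0r scaler0 linear0.
  rewrite (le_trans br rs) linearZ /= g_map // vsprojK //.
  by rewrite mem_interval // in_t (le_trans br rs).
apply: inj_surj_bij => [x y|y] /=.
  rewrite !big_ord1 /f => xy; apply/ffunP => l; rewrite (ord1 l).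
  case: (leP b r) xy => br xy; last first.
    by rewrite [LHS]out_bar0 ?[RHS]out_bar0 ?in_t -?ltNge.
  apply: val_inj; apply/eqP; move/eqP: xy; rewrite -subr_eq0 -scalerBl.
  by rewrite scaler_eq0 (negPf (g_neq0 br)) orbF subr_eq0.
case: (leP b r) => br; last first.
  by exists [ffun l => 0]; rewrite [LHS]before_b ?[RHS]before_b.
have [->|->] := g_gen y br.
  by exists [ffun l => 0]; rewrite big_ord1 ffunE /f scale0r.
exists [ffun l => bar_gen (tnth (in_tuple [:: ray]) l) r].
by rewrite big_ord1 ffunE /f br bar_genE ?in_t // scale1r.
Qed.

(** From [b] on the only nonzero element at level [r] is [g r], so bars alive at the same level
    share it and must be the same bar. Since [g] never dies, that bar has no finite end. *)
Lemma barcode_ray : barcode M = [mset ray].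
Proof.
apply: classical_sets.xget_unique; first exact: decomposes_ray.
move=> D [Dne [iota iotaN iotaB]].
pose J l := tnth (in_tuple (enum_mset D)) l.
have Jstart l : in_bar (J l) (J l).1 by apply/bar_start/Dne/mem_tnth.
have eltg l r : in_bar (J l) r -> b <= r /\ bar_elt iota l r = g r.
  move=> Jr; have e0 := bar_elt_neq0 iotaB Jr.
  have br : b <= r by rewrite leNgt; apply: contra e0 => rb; apply/eqP/before_b.
  by split=> //; case: (g_gen (bar_elt iota l r) br) e0 => [->|//]; rewrite eqxx.
have Jinf l s : (J l).1 <= s -> in_bar (J l) s.
  move=> rs; apply: contraT => Js; have [br eg] := eltg l _ (Jstart l).
  have := bar_elt_dies iotaN rs Js; rewrite eg g_map // => /eqP.
  by rewrite (negPf (g_neq0 (le_trans br rs))).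
(* Neither bar ever ends, so both are alive at the larger of their two starts. *)
have one (l l' : 'I_(size (enum_mset D))) : l = l'.
  have [|_ e] := eltg l (Num.max (J l).1 (J l').1).
    by apply: Jinf; rewrite le_max lexx.
  apply: (bar_elt_inj iotaB (r := Num.max (J l).1 (J l').1)).
    by apply: Jinf; rewrite le_max lexx.
  rewrite e; have [|_ e'] := eltg l' (Num.max (J l).1 (J l').1).
    by apply: Jinf; rewrite le_max lexx orbT.
  by rewrite e'.
(* Some bar carries the nonzero element [g b]. It cannot start earlier, because the module vanishes
   before [b]. *)
have [l Jb] := alive_bar iotaB (g_neq0 (lexx b)).
have Jl : J l = ray.
  have [bJ _] := eltg l _ (Jstart l).
  case/andP: (Jb) => Jb1 _; have J1 : (J l).1 = b by apply/le_anti; rewrite Jb1.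
  suff J2 : (J l).2 = +oo%E by rewrite [LHS]surjective_pairing J1 J2.
  case E2: (J l).2 => [t| |] //; last first.
    by move: Jb; rewrite /in_bar E2 andbC ltNge leNye.
  have bt : b < t by case/andP: Jb; rewrite E2 lte_fin.
  have /andP[_] : in_bar (J l) t by apply: Jinf; rewrite J1 ltW.
  by rewrite E2 lte_fin ltxx.
have D1 : size (enum_mset D) = 1%N.
  move: one l {Jb Jl}; case: (size _) => [|[|m]] // one'; first by case.
  by have := one' ord0 ord_max.
have /all_pred1P : all (pred1 ray) (enum_mset D).
  apply/allP => x /(tnthP (in_tuple _))[l' ->]; rewrite -[tnth _ _]/(J l').
  by rewrite (one l' l) Jl /= eqxx.
rewrite D1 => sD.
by rewrite -[D]seq_mset_id sD -(enum_msetn 1 ray) seq_mset_id.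
Qed.

End Ray.
End PersistenceModules.

(** * Chain maps and induced maps *)

Section Chains.
Variables (R : realType) (X : filtered_complex R).
Implicit Types (k : nat) (A : {set cell X}) (c : chain X).

(** Replaces the span of basis chains by a condition on supports, the form in which membership is
    used below. *)
Lemma mem_chainsP k A c :
  reflect (forall s, c s != 0 -> s \in A /\ cdim s = k) (c \in chains k A).
Proof.
apply: (iffP idP) => [cA s|cA].
  pose S := [seq cell_chain s | s <- enum [set s in A | cdim s == k]].
  rewrite (coord_span (X := in_tuple S) cA) sum_ffunE => cs0.
  have [i _] :
      exists2 i, true & (coord (in_tuple S) i c *: (in_tuple S)`_i) s != 0.
    apply/exists_inP; apply: contraNT cs0 => /exists_inPn c0.
    by rewrite big1 // => i _; apply/eqP; rewrite -[_ == _]negbK c0.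
  have /mapP[t tA ->] : (in_tuple S)`_i \in S by apply: mem_nth.
  rewrite !ffunE; have [-> _|_] := eqVneq s t; last by rewrite scaler0 eqxx.
  by move: tA; rewrite mem_enum inE => /andP[? /eqP].
have -> : c = \sum_s c s *: cell_chain s.
  apply/ffunP => t; rewrite sum_ffunE (bigD1 t) //= big1 ?addr0 => [|s st].
    by rewrite !ffunE eqxx [RHS]mulr1.
  by rewrite !ffunE eq_sym (negPf st) scaler0.
apply: memv_suml => s _; have [->|/cA[sA sk]] := eqVneq (c s) 0.
  by rewrite scale0r mem0v.
apply/memvZ/memv_span/map_f.
by rewrite mem_enum inE sA sk eqxx.
Qed.

Lemma mem_cyclesP k A c :
  c \in cycles k A <-> c \in chains k A /\ bd c = 0.
Proof.
rewrite /cycles memv_cap memv_ker lfunE /=.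
by split=> [/andP[-> /eqP]|[-> ->]]; last rewrite eqxx.
Qed.

Lemma mem_boundariesP k A c :
  c \in boundaries k A <-> exists2 b, b \in chains k.+1 A & c = bd b.
Proof.
split=> [/memv_imgP[b bA ->]|[b bA ->]]; first by exists b; rewrite ?lfunE.
by apply/memv_imgP; exists b; rewrite ?lfunE.
Qed.

End Chains.

Section InducedMap.
Variables (R : realType) (X Y : filtered_complex R).
Variable F : {linear chain X -> chain Y}.
Variables (k : nat) (A : {set cell X}) (B : {set cell Y}).

(** With [repr] and [vsproj] this is defined for any [F]. It is the map induced on classes once [F]
    preserves cycles and boundaries. *)
Definition induced (x : homology k A) : homology k B :=
  vpi (bd_in_cycles k B) (vsproj (cycles k B) (F (vsval (repr x)))).

Hypothesis F_cycles : forall z, z \in cycles k A -> F z \in cycles k B.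
Hypothesis F_bounds : forall z, z \in boundaries k A -> F z \in boundaries k B.

Lemma inducedE (z : subvs_of (cycles k A)) :
  induced (vpi (bd_in_cycles k A) z) =
  vpi (bd_in_cycles k B) (vsproj (cycles k B) (F (vsval z))).
Proof.
apply: vpiP; rewrite mem_bd_in_cycles linearB /= !vsprojK ?F_cycles ?subvsP //.
by rewrite -!linearB F_bounds // -mem_bd_in_cycles repr_vpi.
Qed.

Lemma induced_linear : linear induced.
Proof.
move=> a x y; rewrite -[x]vpi_repr -[y]vpi_repr -linearP !inducedE.
by rewrite -linearP -!linearP.
Qed.

Lemma induced_bij :
  (forall z, z \in cycles k A -> F z \in boundaries k B ->
     z \in boundaries k A) ->
  (forall z, z \in cycles k B ->
     exists2 y, y \in cycles k A & z - F y \in boundaries k B) ->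
  bijective induced.
Proof.
move=> F_inj F_surj; apply: inj_surj_bij => [x y|y].
  rewrite -[x]vpi_repr -[y]vpi_repr !inducedE => /eqP.
  rewrite vpi_eq mem_bd_in_cycles linearB /= !vsprojK ?F_cycles ?subvsP //.
  rewrite -!linearB => /F_inj xy; apply: vpiP; rewrite mem_bd_in_cycles xy //.
  exact: subvsP.
have [x xA yx] := F_surj _ (subvsP (repr y)).
exists (vpi _ (vsproj (cycles k A) x)); rewrite inducedE -[RHS]vpi_repr.
apply/esym/vpiP; rewrite mem_bd_in_cycles linearB /= vsprojK.
  by rewrite vsprojK.
by apply: F_cycles; rewrite vsprojK.
Qed.

End InducedMap.

(** One chain map [F] serves all levels, so naturality comes for free. The last two hypotheses are
    injectivity and surjectivity on homology, unfolded to chains. *)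
Lemma Dgm_deg_chain_map (R : realType) (X Y : filtered_complex R)
    (F : {linear chain X -> chain Y}) (k : nat) :
  (forall r z, z \in cycles k (sublevel X r) -> F z \in cycles k (sublevel Y r)) ->
  (forall r z, z \in boundaries k (sublevel X r) ->
     F z \in boundaries k (sublevel Y r)) ->
  (forall r z, z \in cycles k (sublevel X r) ->
     F z \in boundaries k (sublevel Y r) -> z \in boundaries k (sublevel X r)) ->
  (forall r z, z \in cycles k (sublevel Y r) ->
     exists2 y, y \in cycles k (sublevel X r) &
       z - F y \in boundaries k (sublevel Y r)) ->
  Dgm_deg X k = Dgm_deg Y k.
Proof.
move=> F_cyc F_bnd F_inj F_surj.
pose phi r := HB.pack_for {linear pers_homology X k r -> pers_homology Y k r}
  (@induced _ X Y F k (sublevel X r) (sublevel Y r))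
  (GRing.isLinear.Build _ _ _ _ _ (induced_linear (F_cyc r) (F_bnd r))).
apply: (barcode_bij (phi := phi)) => [r s rs x|r]; last first.
  apply: induced_bij;
    [exact: F_cyc | exact: F_bnd | exact: F_inj | exact: F_surj].
have rsX := sublevelS X rs; have rsY := sublevelS Y rs.
rewrite -(vpi_repr x) /= homology_mapE // !inducedE;
  try by [exact: F_cyc | exact: F_bnd].
rewrite homology_mapE //; congr vpi; apply: val_inj => /=.
rewrite cycle_inclE // !vsprojK ?cycle_inclE ?F_cyc ?subvsP //.
all: by apply/(subvP (cyclesS k rsX))/subvsP.
Qed.

(** * Closed embeddings of complexes *)

Definition aug (R : realType) (X : filtered_complex R) (c : chain X) : 'F_2 :=
  \sum_(s | cdim s == 0%N) c s.

Lemma augB (R : realType) (X : filtered_complex R) (c c' : chain X) :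
  aug (c - c') = aug c - aug c'.
Proof.
by rewrite /aug -sumrB; apply: eq_bigr => s _; rewrite !ffunE.
Qed.

Section ClosedEmbedding.
Variables (R : realType) (X Y : filtered_complex R) (e : cell X -> cell Y).
Hypothesis e_inj : injective e.
Hypothesis e_dim : forall s, cdim (e s) = cdim s.
Hypothesis e_face : forall s t, face (e s) (e t) = face s t.
Hypothesis e_closed : forall s t, face s (e t) -> exists s', s = e s'.
Hypothesis e_val : forall s, fval (e s) = fval s.

Definition push (c : chain X) : chain Y := [ffun t => \sum_(s | e s == t) c s].

Lemma push_linear : linear push.
Proof.
move=> a x y; apply/ffunP => t; rewrite !ffunE scaler_sumr -big_split /=.
by apply: eq_bigr => s _; rewrite !ffunE.
Qed.

HB.instance Definition _ := GRing.isLinear.Build _ _ _ _ push push_linear.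

Lemma push_im c s : push c (e s) = c s.
Proof.
by rewrite ffunE (big_pred1 s) // => t; rewrite /= (inj_eq e_inj).
Qed.

Lemma push_neq0 c t : push c t != 0 -> exists2 s, t = e s & c s != 0.
Proof.
rewrite ffunE => ct.
have /exists_inP[s /eqP <- cs] : [exists (s | e s == t), c s != 0].
  apply: contraNT ct => /exists_inPn c0; rewrite big1 // => s st.
  by apply/eqP; rewrite -[_ == _]negbK c0.
by exists s.
Qed.

(** On the image the incidences agree. Off the image both sides vanish, because [e_closed] puts
    every face of an image cell back in the image. *)
Lemma bd_push c : bd (push c) = push (bd c).
Proof.
apply/ffunP => t; rewrite !ffunE.
under eq_bigr do rewrite ffunE.
rewrite (exchange_big_dep predT) //=.
have [/existsP[s /eqP <-]|/existsPn t_out] := boolP [exists s, e s == t].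
  rewrite [RHS](big_pred1 s) => [|s' /=]; last by rewrite (inj_eq e_inj).
  rewrite ffunE.
  rewrite [RHS]big_mkcond; apply: eq_bigr => s' _.
  case: ifP => ss'.
    rewrite (big_pred1 (e s')) // => t' /=; rewrite [RHS]eq_sym.
    by case: (e s' =P t') => [<-|_]; rewrite ?andbF // andbT e_face !e_dim.
  rewrite big1 // => t' /andP[/[swap] /eqP t'E].
  by rewrite -t'E e_face !e_dim ss'.
rewrite [RHS]big_pred0 => [|s]; last exact/negbTE/t_out.
apply: big1 => s _; apply: big1 => t' /andP[/andP[tt' _] /eqP t'E].
move: tt'; rewrite -t'E => /e_closed[s' tE].
by have := t_out s'; rewrite tE eqxx.
Qed.

Lemma aug_push c : aug (push c) = aug c.
Proof.
rewrite /aug; under eq_bigr do rewrite ffunE.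
rewrite (exchange_big_dep (fun s => cdim s == 0%N)) => [|t s t0 /eqP st] /=.
  apply: eq_bigr => s s0; rewrite (big_pred1 (e s)) // => t /=.
  by rewrite [RHS]eq_sym; case: (e s =P t) => [<-|_]; rewrite ?andbF // e_dim s0.
by rewrite -e_dim st.
Qed.

Lemma push_chains k r c :
  (push c \in chains k (sublevel Y r)) = (c \in chains k (sublevel X r)).
Proof.
apply/mem_chainsP/mem_chainsP => [cY s cs|cX t /push_neq0[s -> /cX]].
  by have := cY (e s); rewrite push_im !inE e_val e_dim => /(_ cs).
by rewrite !inE e_val e_dim.
Qed.

Lemma push_cycles k r c :
  (push c \in cycles k (sublevel Y r)) <-> (c \in cycles k (sublevel X r)).
Proof.
rewrite !mem_cyclesP push_chains bd_push.
split=> -[-> b0]; split=> //; last by rewrite b0 linear0.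
by apply/ffunP => s; rewrite -push_im b0 !ffunE.
Qed.

Lemma push_boundaries k r c : c \in boundaries k (sublevel X r) ->
  push c \in boundaries k (sublevel Y r).
Proof.
move=> /mem_boundariesP[b bX ->]; apply/mem_boundariesP.
by exists (push b); rewrite ?push_chains ?bd_push.
Qed.

Lemma push_restrict (c : chain Y) : (forall t, c t != 0 -> exists s, t = e s) ->
  c = push [ffun s => c (e s)].
Proof.
move=> c_im; apply/ffunP => t; have [c0|ct] := eqVneq (c t) 0; last first.
  by have [s ->] := c_im t ct; rewrite push_im ffunE.
rewrite c0 ffunE; symmetry; apply: big1 => s /eqP st.
by rewrite ffunE st.
Qed.

(** Below [N] every cell of the sublevel set of [Y] comes from [X], so chains and bounding chains
    restrict to [X]. Only the levels from [N] on remain, and they are left to the last two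
    hypotheses. *)
Lemma Dgm_deg_embedding k N :
  (forall t, fval t < N -> exists s, t = e s) ->
  (forall r y b, N <= r -> y \in cycles k (sublevel X r) ->
     b \in chains k.+1 (sublevel Y r) -> push y = bd b ->
     y \in boundaries k (sublevel X r)) ->
  (forall r z, N <= r -> z \in cycles k (sublevel Y r) ->
     exists2 y, y \in cycles k (sublevel X r) &
       z - push y \in boundaries k (sublevel Y r)) ->
  Dgm_deg X k = Dgm_deg Y k.
Proof.
move=> imN push_inj_above push_surj_above.
have restr r k' c : r < N -> c \in chains k' (sublevel Y r) ->
    c = push [ffun s => c (e s)].
  move=> rN /mem_chainsP cY; apply: push_restrict => t /cY[].
  by rewrite inE => tr _; apply: imN; apply: le_lt_trans rN.
apply: (@Dgm_deg_chain_map R X Y push) => r z /=.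
- by move=> ?; apply/push_cycles.
- exact: push_boundaries.
- move=> zX /mem_boundariesP[b bY zb].
  have [Nr|rN] := leP N r; first exact: push_inj_above zb.
  apply/mem_boundariesP; exists [ffun s => b (e s)].
    by rewrite -push_chains -(restr r k.+1).
  apply/ffunP => s; rewrite -!push_im zb -bd_push -(restr r k.+1) //.
- have [Nr|rN] := leP N r; first exact: push_surj_above.
  move=> zY; have zE := restr r k z rN ((mem_cyclesP _ _ _).1 zY).1.
  exists [ffun s => z (e s)]; first by apply/push_cycles; rewrite -zE.
  by rewrite /= -zE subrr mem0v.
Qed.

End ClosedEmbedding.

(** * Operators acting on one coordinate of the cubes *)

(** One entry of the identity [D H + H D = 1 + P] for a segment with [n] elementary intervals, after
    the sparse sums have collapsed. The proof splits on the parities of [a] and [b] and compares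
    their halves. *)
Lemma mxDH_entry (n a b : nat) : odd n -> (a < n)%N -> (b < n)%N ->
  (~~ odd a * ((a.+1 < n) * [&& odd a.+1, ~~ odd b & a.+1 < b] +
               (0 < a) * [&& odd a.-1, ~~ odd b & a.-1 < b]) +
   odd b * ([&& odd a, ~~ odd b.+1 & a < b.+1] +
            [&& odd a, ~~ odd b.-1 & a < b.-1]) =
   (a == b) + ((a == 0) && ~~ odd b) %[mod 2])%N.
Proof.
move=> n_odd an bn.
have odd_pred (x : nat) : odd x.-1 = (0 < x)%N && ~~ odd x.
  by case: x => //= x; rewrite negbK.
rewrite !odd_pred /=; move: an bn {odd_pred}.
rewrite -(odd_double_half n) n_odd -(odd_double_half a) -(odd_double_half b).
move: (n./2) (a./2) (b./2) => l k m.
case: (odd a); case: (odd b) => an bn;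
  rewrite /= ?add0n ?add1n /= ?odd_double /= ?odd_double /=;
  rewrite ?mul0n ?mul1n ?andbT ?andbF ?addn0 ?add0n.
- by case: (ltngtP k m) => km; lia.
- by lia.
- by lia.
by case: (ltngtP k m) => km; case: (posnP k) => k0; lia.
Qed.

Section CubeOperators.
Variables (d : nat) (w : 'I_d -> nat).
Implicit Types (s t : cube w) (i j : 'I_d).

(** The type of a coordinate depends on its index, so the new value passes through [nat]. It is
    always in range, hence the default [s j] of [insubd] is never taken. *)
Definition upd s i (a : 'I_(w i)) : cube w :=
  [ffun j => insubd (s j) (if j == i then a : nat else s j : nat)].

Arguments upd : clear implicits.

Lemma val_upd s i (a : 'I_(w i)) j :
  upd s i a j = (if j == i then a : nat else s j) :> nat.
Proof.
rewrite ffunE val_insubd; case: eqP => [->|_]; first by rewrite ltn_ord.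
by rewrite if_same.
Qed.

Lemma upd_eq s i (a : 'I_(w i)) : upd s i a i = a.
Proof. by apply: val_inj; rewrite /= val_upd eqxx. Qed.

Lemma upd_neq s i (a : 'I_(w i)) j : j != i -> upd s i a j = s j.
Proof. by move=> /negPf ji; apply: val_inj; rewrite /= val_upd ji. Qed.

Lemma eq_cube s t : (forall i, s i = t i :> nat) -> s = t.
Proof. by move=> st; apply/ffunP => i; apply/val_inj/st. Qed.

Lemma upd_upd s i (a b : 'I_(w i)) : upd (upd s i a) i b = upd s i b.
Proof. by apply: eq_cube => j; rewrite !val_upd; case: eqP. Qed.

Lemma upd_id s i : upd s i (s i) = s.
Proof. by apply: eq_cube => j; rewrite val_upd; case: eqP => [->|]. Qed.

Lemma updC s i j (a : 'I_(w i)) (b : 'I_(w j)) : i != j ->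
  upd (upd s i a) j b = upd (upd s j b) i a.
Proof.
move=> ij; apply: eq_cube => l; rewrite !val_upd.
by case: eqP => // ->; rewrite eq_sym (negPf ij).
Qed.

Lemma cube_dimE s : cube_dim s = (\sum_i odd (s i))%N.
Proof.
rewrite /cube_dim -sum1dep_card big_mkcond.
by apply: eq_bigr => i _; case: odd.
Qed.

Lemma cube_dim_le s : (cube_dim s <= d)%N.
Proof. by rewrite /cube_dim -[X in (_ <= X)%N]card_ord max_card. Qed.

Lemma cube_dim_upd s i (a : 'I_(w i)) :
  (cube_dim (upd s i a) + odd (s i) = cube_dim s + odd a)%N.
Proof.
rewrite !cube_dimE (bigD1 i) //= [in RHS](bigD1 i) //= val_upd eqxx.
rewrite (eq_bigr (fun j => nat_of_bool (odd (s j)))) => [|j ji]; first by lia.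
by rewrite val_upd (negPf ji).
Qed.

(** Turns a sum over one coordinate into a sum over the cubes on the line through [s] in direction
    [i], so that it can be exchanged with sums over cubes. *)
Lemma sum_upd (V : nmodType) s i (F : cube w -> V) :
  \sum_a F (upd s i a) = \sum_(t : cube w | t == upd s i (t i)) F t.
Proof.
rewrite [RHS](reindex_onto (upd s i) (fun t => t i)) => [|t /eqP <-] //=.
by apply: eq_bigl => a; rewrite upd_eq !eqxx.
Qed.

Local Notation C := {ffun cube w -> ('F_2)^o}.

Lemma addCC (c : C) : c + c = 0.
Proof. by apply/ffunP => s; rewrite !ffunE addF2. Qed.

(** Chains of a box form the tensor product of the chains of its segments; this is [M] acting on
    factor [i] and the identity on the others. *)
Definition op i (M : 'M['F_2]_(w i)) (c : C) : C :=
  [ffun s : cube w => \sum_a M (s i) a * c (upd s i a)].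

Arguments op : clear implicits.

Lemma op_linear i (M : 'M['F_2]_(w i)) : linear (op i M).
Proof.
move=> k x y; apply/ffunP => s; rewrite !ffunE scaler_sumr -big_split /=.
by apply: eq_bigr => a _; rewrite !ffunE mulrDr scalerAr.
Qed.

HB.instance Definition _ i M :=
  GRing.isLinear.Build _ _ _ _ (op i M) (@op_linear i M).

Lemma opD i (M M' : 'M['F_2]_(w i)) c : op i (M + M') c = op i M c + op i M' c.
Proof.
apply/ffunP => s; rewrite !ffunE -big_split /=.
by apply: eq_bigr => a _; rewrite mxE mulrDl.
Qed.

Lemma op0 i c : op i (0 : 'M['F_2]_(w i)) c = 0.
Proof. by apply/ffunP => s; rewrite !ffunE big1 // => a _; rewrite mxE mul0r. Qed.

Lemma op1 i c : op i (1%:M : 'M['F_2]_(w i)) c = c.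
Proof.
apply/ffunP => s; rewrite ffunE (bigD1 (s i)) //= big1 => [|a /negPf sa].
  by rewrite mxE eqxx mul1r addr0 upd_id.
by rewrite mxE eq_sym sa mul0r.
Qed.

Lemma opM i (M M' : 'M['F_2]_(w i)) c : op i M (op i M' c) = op i (M *m M') c.
Proof.
apply/ffunP => s; rewrite !ffunE.
under eq_bigr do rewrite ffunE mulr_sumr.
rewrite exchange_big; apply: eq_bigr => b _; rewrite mxE mulr_suml.
by apply: eq_bigr => a _; rewrite mulrA upd_eq upd_upd.
Qed.

Lemma opC i j (M : 'M['F_2]_(w i)) (M' : 'M['F_2]_(w j)) c : i != j ->
  op i M (op j M' c) = op j M' (op i M c).
Proof.
move=> ij; apply/ffunP => s; rewrite !ffunE.
under eq_bigr do rewrite ffunE mulr_sumr.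
rewrite exchange_big; apply: eq_bigr => b _; rewrite ffunE mulr_sumr.
apply: eq_bigr => a _; rewrite (updC _ _ _ ij) mulrCA.
by rewrite !upd_neq // eq_sym.
Qed.

Lemma op_neq0 i (M : 'M['F_2]_(w i)) c s : op i M c s != 0 ->
  exists a, M (s i) a != 0 /\ c (upd s i a) != 0.
Proof.
rewrite ffunE => Mc; suff /existsP[a /andP[Ma ca]] :
    [exists a, (M (s i) a != 0) && (c (upd s i a) != 0)] by exists a.
apply: contraNT Mc => /existsPn M0; rewrite big1 // => a _.
by have := M0 a; rewrite -negb_or negbK => /orP[] /eqP ->; rewrite ?mul0r ?mulr0.
Qed.

Definition incident (a b : nat) : bool :=
  [&& ~~ odd a, odd b & (a.+1 == b) || (a == b.+1)].

(* Chains are acted on by rows, so column b holds the image of interval b: mxD is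
   the boundary of the segment, mxH contracts it to its left end and mxP is the
   resulting retraction onto that end. *)
Definition mxD i : 'M['F_2]_(w i) := \matrix_(a, b) (incident a b)%:R.

Definition mxH i : 'M['F_2]_(w i) :=
  \matrix_(a, b) [&& odd a, ~~ odd b & (a < b)%N]%:R.

Definition mxP i : 'M['F_2]_(w i) := \matrix_(a, b) ((a == 0 :> nat) && ~~ odd b)%:R.

Lemma sum_delta n (m : nat) (G : nat -> 'F_2) :
  \sum_(a < n) (a == m :> nat)%:R * G a = (m < n)%:R * G m.
Proof.
have [mn|nm] := ltnP m n; last first.
  rewrite mul0r big1 // => a _; suff /negPf -> : a != m :> nat by rewrite mul0r.
  by rewrite neq_ltn (leq_trans (ltn_ord a) nm).
rewrite (bigD1 (Ordinal mn)) //= eqxx big1 ?addr0 // => a /negPf am.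
suff -> : (a == m :> nat) = false by rewrite mul0r.
exact: am.
Qed.

Lemma incident_row n (a : nat) (G : nat -> 'F_2) : (a < n)%N ->
  \sum_(b < n) (incident a b)%:R * G b =
  (~~ odd a)%:R * ((a.+1 < n)%:R * G a.+1 + (0 < a)%:R * G a.-1).
Proof.
move=> an; have [oa|ea] /= := boolP (odd a).
  by rewrite mul0r big1 // => b _; rewrite /incident oa mul0r.
have an' : (a.-1 < n)%N by apply: leq_ltn_trans an; apply: leq_pred.
have := sum_delta n a.-1 G; rewrite an' !mul1r => <-; rewrite -sum_delta.
rewrite mulr_sumr -big_split /=; apply: eq_bigr => b _.
rewrite mulrA -mulrDl; congr (_ * _); rewrite -natrM -natrD; congr _%:R.
rewrite /incident ea /=; lia.
Qed.

(** As [n] is odd the last interval is a vertex, so both ends of an edge are in range and, unlike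
    for rows, no end conditions appear. *)
Lemma incident_col n (b : nat) (G : nat -> 'F_2) : (b < n)%N -> odd n ->
  \sum_(a < n) G a * (incident a b)%:R = (odd b)%:R * (G b.+1 + G b.-1).
Proof.
move=> bn on; have [ob|eb] /= := boolP (odd b); last first.
  by rewrite mul0r big1 // => a _; rewrite /incident (negPf eb) andbF mulr0.
have := sum_delta n b.-1 G; have := sum_delta n b.+1 G.
have -> : (b.-1 < n)%N by lia.
have -> : (b.+1 < n)%N by lia.
rewrite !mul1r => <- <-; rewrite -big_split /=; apply: eq_bigr => a _.
rewrite -mulrDl mulrC; congr (_ * _); rewrite -natrD; congr _%:R.
rewrite /incident ob /=; lia.
Qed.

Lemma mxDP i : mxD i *m mxP i = 0.
Proof.
apply/matrixP => a b; rewrite !mxE big1 // => c _; rewrite !mxE.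
by rewrite -natrM mulnb /incident; case: (c : nat) => [|n]; rewrite ?andbF.
Qed.

Hypothesis w_odd : forall i, odd (w i).

(** The two ends of an edge are both retracted to the left end of the segment and cancel modulo
    2. *)
Lemma mxPD i : mxP i *m mxD i = 0.
Proof.
apply/matrixP => a b; rewrite !mxE; under eq_bigr do rewrite !mxE.
rewrite (incident_col (fun x => ((a == 0 :> nat) && ~~ odd x)%:R)) //.
by case: b => -[|b] //= bw; rewrite ?mul0r // negbK addF2 mulr0.
Qed.

Lemma mxDH i : mxD i *m mxH i + mxH i *m mxD i = 1%:M + mxP i.
Proof.
apply/matrixP => a b; rewrite !mxE.
under eq_bigr do rewrite !mxE.
under [X in _ + X]eq_bigr do rewrite !mxE.
rewrite (incident_row (fun x => [&& odd x, ~~ odd b & (x < b)%N]%:R)) //.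
rewrite (incident_col (fun x => [&& odd a, ~~ odd x & (a < x)%N]%:R)) //.
have aw := ltn_ord a; have bw := ltn_ord b; have wi := w_odd i.
rewrite -!natrM -!natrD -!natrM -!natrD.
rewrite -[a == b]/(a == b :> nat).
move: (a : nat) (b : nat) aw bw => {}a {}b aw bw.
by apply/val_inj; rewrite /= !val_Fp_nat //; apply: mxDH_entry aw bw.
Qed.

End CubeOperators.

Arguments upd {d w} s i a.
Arguments op {d w} i M c.

(** * Homology of a box *)

Section BoxHomology.
Variables (R : realType) (d : nat) (w : 'I_d -> nat) (f : cube w -> R).
Local Notation X := (cubical f).
Implicit Types (c z : chain X) (s t : cube w).

Lemma incidence s t :
  cube_face s t && (cube_dim t == (cube_dim s).+1) =
  [exists i : 'I_d, (t == upd s i (t i)) && incident (s i) (t i)].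
Proof.
apply/andP/existsP => [[/forallP st /eqP dim_t]|[i /andP[/eqP tE]]].
  (* Passing to a face can only turn edge coordinates into vertices. A drop of one in dimension
     therefore singles out one coordinate. *)
  have so i : odd (s i) -> s i = t i :> nat.
    by have := st i; rewrite /elem_face; lia.
  have : #|[set i : 'I_d | odd (t i)] :\: [set i : 'I_d | odd (s i)]| = 1%N.
    move: dim_t; rewrite /cube_dim => dim_t.
    rewrite cardsD (setIidPr _) ?dim_t ?subSnn //.
    by apply/fintype.subsetP => i; rewrite !inE => si; rewrite -so.
  move=> /eqP/cards1P[i iE]; exists i.
  have off j : j != i -> s j = t j :> nat.
    move=> ji; have := st j; rewrite /elem_face => /orP[/eqP //|/andP[ot tj]].
    have /setP/(_ j) := iE; rewrite !inE ot (negPf ji) andbT.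
    by move=> /negbFE /so.
  have /setP/(_ i) := iE; rewrite !inE eqxx => /andP[es ot].
  apply/andP; split.
    by apply/eqP/eq_cube => j; rewrite val_upd; case: eqP => [->|/eqP /off].
  by have := st i; rewrite /incident /elem_face es ot /=; case: eqP => // st'; lia.
move=> /and3P[es ot sti]; split; last first.
  by apply/eqP; have := cube_dim_upd s (t i); rewrite -tE ot (negPf es); lia.
apply/forallP => j; rewrite /elem_face.
have [->|ji] := eqVneq j i; first by rewrite ot sti orbT.
by rewrite {1}tE upd_neq // eqxx.
Qed.

(** The Leibniz rule for a product of segments, without signs over ['F_2]. *)
Lemma bd_op c : bd c = \sum_i op i (mxD w i) c.
Proof.
apply/ffunP => s; rewrite ffunE sum_ffunE.
under [RHS]eq_bigr do rewrite ffunE.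
under [RHS]eq_bigr => i _.
  under eq_bigr => a _ do rewrite mxE -{1}(upd_eq s a).
  rewrite (sum_upd s i (fun t => (incident (s i) (t i))%:R * c t)).
  over.
rewrite /= (exchange_big_dep predT) //= big_mkcond; apply: eq_bigr => t _.
rewrite incidence; case: existsP => [[i /andP[tE sti]]|no_i]; last first.
  rewrite big1 // => i tE; case: (boolP (incident _ _)) => sti.
    by case: no_i; exists i; rewrite tE.
  by rewrite mul0r.
(* A coface of [s] lies in one direction only: on a line in another direction [j] the coordinates
   [i] would agree, against the parities in [incident]. *)
rewrite (bigD1 i) //= sti mul1r big1 ?addr0 // => j /andP[tE' ji].
have : s i = t i by rewrite (eqP tE') upd_neq // eq_sym.
by move: sti => /[swap] ->; rewrite /incident; case: odd.
Qed.

Lemma chains_full k c :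
  reflect (forall s, c s != 0 -> cube_dim s = k) (c \in chains k [set: cell X]).
Proof.
by apply: (iffP (mem_chainsP _ _ _)) => h s /h => [[]|] //; rewrite inE.
Qed.

Lemma op_chains k l i (M : 'M['F_2]_(w i)) c :
  (forall a b, M a b != 0 -> (odd a + k = odd b + l)%N) ->
  c \in chains k [set: cell X] -> op i M c \in chains l [set: cell X].
Proof.
move=> Mkl /chains_full ck; apply/chains_full => s /op_neq0[a [/Mkl sa /ck]].
by have := cube_dim_upd s a; lia.
Qed.

Hypothesis w_odd : forall i, odd (w i).

(** Direction [i] contributes the identity for the segment. In every other direction the operators
    commute, so the same term occurs twice and cancels. *)
Lemma homotopy i c :
  bd (op i (mxH w i) c : chain X) + op i (mxH w i) (bd c) = c + op i (mxP w i) c.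
Proof.
rewrite !bd_op linear_sum -big_split /= (bigD1 i) //= big1 ?addr0 => [|j ji].
  by rewrite !opM -opD mxDH // opD op1.
by rewrite opC // addCC.
Qed.

Lemma bd_opP i c : bd (op i (mxP w i) c : chain X) = op i (mxP w i) (bd c).
Proof.
rewrite !bd_op linear_sum; apply: eq_bigr => j _ /=.
have [->|ji] := eqVneq j i; last by rewrite opC.
by rewrite !opM mxDP mxPD // !op0.
Qed.

Lemma opH_chains k i c : c \in chains k [set: cell X] ->
  op i (mxH w i) c \in chains k.+1 [set: cell X].
Proof.
apply: op_chains => a b; rewrite mxE.
by case: and3P => [[-> /negPf -> _]|]; rewrite ?eqxx // => _; lia.
Qed.

Lemma opP_chains k i c : c \in chains k [set: cell X] ->
  op i (mxP w i) c \in chains k [set: cell X].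
Proof.
apply: op_chains => a b; rewrite mxE.
by case: andP => [[/eqP -> /negPf ->]|]; rewrite ?eqxx.
Qed.

(** Induction on the directions: [mxP] pushes coordinate [i] to 0 and leaves the others alone, so
    earlier directions stay at 0, and the homotopy bounds the change. *)
Lemma cycle_retract k z (l : seq 'I_d) : z \in cycles k [set: cell X] ->
  exists z0, [/\ z0 \in cycles k [set: cell X],
    z - z0 \in boundaries k [set: cell X] &
    forall s i, z0 s != 0 -> i \in l -> s i = 0%N :> nat].
Proof.
move=> zk; elim: l => [|i l [z0 [z0k zz0 z00]]].
  by exists z; rewrite subrr mem0v; split.
have [z0c bz0] := (mem_cyclesP _ _ _).1 z0k.
exists (op i (mxP w i) z0); split.
- by apply/mem_cyclesP; rewrite opP_chains // bd_opP bz0 linear0.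
- rewrite -(subrKA z0) memvD //; apply/mem_boundariesP.
  exists (op i (mxH w i) z0); first exact: opH_chains.
  have := homotopy i z0; rewrite bz0 linear0 addr0 => ->; congr (_ + _).
  by apply/eqP; rewrite eq_sym -addr_eq0 addCC.
move=> s j /op_neq0[a [sa z0a]]; rewrite inE.
have [-> _|ji /= jl] := eqVneq j i.
  by move: sa; rewrite mxE; case: andP => [[/eqP]|]; rewrite ?eqxx.
by rewrite -(z00 _ _ z0a jl) upd_neq.
Qed.

(** There are no chains in degree [d.+1], so the homotopy reduces to [z] being equal to its
    retraction. That retraction is supported where coordinate [i] is 0, hence on no [d]-cube, and
    vanishes. *)
Lemma top_cycle0 z : (0 < d)%N -> z \in cycles d [set: cell X] -> z = 0.
Proof.
move=> d_gt0 /mem_cyclesP[zd bz].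
have no_chain c k : (d < k)%N -> c \in chains k [set: cell X] -> c = 0.
  move=> dk /chains_full ck; apply/ffunP => s; rewrite !ffunE.
  by apply/eqP; apply: contraTT dk => /ck <-; rewrite -leqNgt cube_dim_le.
pose i : 'I_d := Ordinal d_gt0; have := homotopy i z.
rewrite bz linear0 addr0 (no_chain _ d.+1 _ (opH_chains i zd)) // linear0.
suff -> : op i (mxP w i) z = 0 by rewrite addr0.
apply/ffunP => s; rewrite [RHS]ffunE; apply/eqP; apply: contraT => Pzs.
have /chains_full/(_ _ Pzs) dims := opP_chains i zd.
have /setP/(_ i) : [set j : 'I_d | odd (s j)] = [set: 'I_d].
  by apply/eqP; rewrite eqEcard subsetT cardsT card_ord [X in (_ <= X)%N]dims leqnn.
have [a [sa _]] := op_neq0 Pzs.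
by move: sa; rewrite mxE !inE; case: andP => [[/eqP ->]|]; rewrite ?eqxx.
Qed.

(** An edge has two ends, which cancel modulo 2; the sum is exchanged so that this is counted for
    each cube [t] and direction [i]. *)
Lemma aug_bd c : aug (bd c) = 0.
Proof.
rewrite bd_op /aug; under eq_bigr do rewrite sum_ffunE.
rewrite exchange_big big1 // => i _.
under eq_bigr => s _.
  rewrite ffunE; under eq_bigr => a _ do rewrite mxE -{1}(upd_eq s a).
  rewrite (sum_upd s i (fun t => (incident (s i) (t i))%:R * c t)).
  over.
rewrite (exchange_big_dep predT) //= big1 // => t _.
rewrite -mulr_suml (eq_bigl (fun s => (s == upd t i (s i)) && (cube_dim s == 0%N))).
  rewrite big_mkcondr -(sum_upd t i) /=.
  (* Only edges have vertices as codimension one faces. For them the condition on the dimension of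
     the face already follows from incidence. *)
  case: (cube_dim t =P 1%N) => [t1|t1].
    have := incident_col (fun=> 1) (ltn_ord (t i)) (w_odd i).
    rewrite addF2 mulr0 => col0.
    rewrite [X in X * _](_ : _ = 0) ?mul0r // -[RHS]col0.
    apply: eq_bigr => a _; rewrite upd_eq mul1r.
    have := cube_dim_upd t a; rewrite t1 /incident.
    by case: (odd a); case: (odd (t i)) => /=; rewrite ?if_same // addn1 => -[->].
  rewrite big1 ?mul0r // => a _; case: eqP => // dim0; rewrite upd_eq.
  have := cube_dim_upd t a; rewrite dim0 /incident.
  by case: (odd a); case: (odd (t i)) => //=; lia.
move=> s; rewrite andbC; congr (_ && _).
by apply/eqP/eqP => ->; rewrite upd_upd upd_id.
Qed.

(** Retracting in all directions leaves a homologous cycle supported at the origin, whose only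
    coefficient is its augmentation. This treats all degrees at once. *)
Lemma box_boundary k z : z \in cycles k [set: cell X] -> aug z = 0 ->
  z \in boundaries k [set: cell X].
Proof.
move=> zk az; have [z0 [z0k zz0 z00]] := cycle_retract (enum 'I_d) zk.
suff z0E : z0 = 0 by rewrite z0E subr0 in zz0.
have origin s : z0 s != 0 -> forall i, s i = 0%N :> nat.
  by move=> z0s i; apply: z00 z0s _; rewrite mem_enum.
have az0 : aug z0 = 0.
  have /mem_boundariesP[b _ zb] := zz0.
  by have := aug_bd b; rewrite -zb augB az sub0r => /eqP; rewrite oppr_eq0 => /eqP.
apply/ffunP => s; rewrite [RHS]ffunE; apply/eqP; apply: contraT => z0s.
have := az0; rewrite /aug (bigD1 s) /=; last first.
  by rewrite cube_dimE big1 // => i _; rewrite (origin s).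
rewrite big1 ?addr0 => [/eqP|t /andP[_ ts]]; first by rewrite (negPf z0s).
apply/eqP; apply: contraNT ts => z0t; apply/eqP/eq_cube => i.
by rewrite !origin.
Qed.

End BoxHomology.

(** * Embeddings of boxes *)

Lemma Dgm_deg_no_cycle (R : realType) (X : filtered_complex R) k :
  (forall z, z \in cycles k [set: cell X] -> z = 0) -> Dgm_deg X k = mset0.
Proof.
move=> X0; apply: barcode0 => r x; rewrite -[x]vpi_repr.
suff -> : repr x = 0 by rewrite linear0.
by apply/val_inj/X0/(subvP (cyclesS k (subsetT _)))/subvsP.
Qed.

(** Degrees above [complex_dim] carry no chains and add nothing, so two complexes can be compared
    over a common range of degrees. *)
Lemma Dgm_le_dim (R : realType) (X : filtered_complex R) m :
  (forall s : cell X, (cdim s <= m)%N) ->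
  Dgm X = seq_mset [seq (k, J) | k <- iota 0 m.+1, J <- enum_mset (Dgm_deg X k)].
Proof.
move=> Xm; have le_m : (complex_dim X <= m)%N by apply/bigmax_leqP => s _.
rewrite /Dgm -(subnKC le_m) -addSn iotaD allpairs_cat.
set above := [seq (k, J) | k <- iota _ (m - _), J <- _].
suff -> : above = [::] by rewrite cats0.
apply/nilP; rewrite /nilp size_allpairs_dep sumnE big_map big1_seq //= => k.
rewrite mem_iota add0n => /andP[dimk _].
rewrite Dgm_deg_no_cycle ?enum_mset0 // => z /mem_cyclesP[/mem_chainsP zk _].
apply/ffunP => s; rewrite [RHS]ffunE; apply/eqP; apply: contraT => /zk[_ sk].
by have := leq_bigmax (F := @cdim R X) s; rewrite -/(complex_dim X) sk; lia.
Qed.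

Section BoxEmbedding.
Variables (R : realType) (d : nat) (w w' : 'I_d -> nat).
Variables (f : cube w -> R) (g : cube w' -> R) (e : cube w -> cube w') (N : R).
Local Notation X := (cubical f).
Local Notation Y := (cubical g).
Hypotheses (w_odd : forall i, odd (w i)) (w'_odd : forall i, odd (w' i)).
Hypothesis e_inj : injective e.
Hypothesis e_dim : forall s, cube_dim (e s) = cube_dim s.
Hypothesis e_face : forall s t, cube_face (e s) (e t) = cube_face s t.
Hypothesis e_closed : forall s t, cube_face s (e t) -> exists s', s = e s'.
Hypothesis e_val : forall s, g (e s) = f s.
Hypothesis e_below : forall t, g t < N -> exists s, t = e s.
Hypotheses (f_le : forall s, f s <= N) (g_le : forall t, g t <= N).

Lemma Dgm_deg_box_embedding k : Dgm_deg X k = Dgm_deg Y k.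
Proof.
have fullX r : N <= r -> sublevel X r = [set: cell X].
  by move=> Nr; apply/setP => s; rewrite !inE (le_trans (f_le s)).
have fullY r : N <= r -> sublevel Y r = [set: cell Y].
  by move=> Nr; apply/setP => s; rewrite !inE (le_trans (g_le s)).
apply: (@Dgm_deg_embedding R X Y e e_inj e_dim e_face e_closed e_val k N) => //.
  (* Both sublevel sets are now full boxes. A pushed cycle that bounds has augmentation 0, and so
     does the original one. *)
  move=> r y b Nr; rewrite fullX ?fullY // => yk _ yb.
  apply: box_boundary => //.
  by rewrite -(@aug_push R X Y e e_dim) yb aug_bd.
move=> r z Nr; rewrite fullX ?fullY // => zk.
have v_lt i : (0 < w i)%N by case: (w i) (w_odd i).
pose v : cube w := [ffun i => Ordinal (v_lt i)].
have dim_v : cube_dim v = 0%N by rewrite cube_dimE big1 // => i _; rewrite ffunE.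
(* A preimage supported at the corner, with the augmentation of [z]. In positive degree [z] has no
   vertices and [y] is 0. *)
pose y : chain X := aug z *: cell_chain (v : cell X).
have yE s : y s = (s == v)%:R * aug z :> 'F_2 by rewrite !ffunE mulrC.
have yk : y \in chains k [set: cell X].
  apply/chains_full => s; rewrite yE; have [->|_] := eqVneq s v; last first.
    by rewrite mul0r eqxx.
  rewrite mul1r dim_v; apply: contraNeq => k0; rewrite /aug big1 // => t /eqP t0.
  apply/eqP; apply: contraNT k0 => zt.
  by have /mem_cyclesP[/chains_full/(_ _ zt) <- _] := zk; apply/eqP.
have yZ : y \in cycles k [set: cell X].
  apply/mem_cyclesP; split=> //; apply/ffunP => s; rewrite !ffunE big1 // => t.
  move=> /andP[_ /eqP ts]; rewrite yE; have [tv|] := eqVneq t v.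
    by move: ts; rewrite tv /= dim_v.
  by rewrite mul0r.
exists y => //; apply: box_boundary => //.
  have [zc bz] := (mem_cyclesP _ _ _).1 zk.
  have [_ by0] := (mem_cyclesP _ _ _).1 yZ.
  apply/mem_cyclesP; split.
    rewrite memvB // -(fullY N) // push_chains //.
    by rewrite fullX.
  by rewrite linearB /= bz (@bd_push R X Y e e_inj e_dim e_face e_closed) by0
    linear0 subr0.
rewrite augB (@aug_push R X Y e e_dim) [aug y](_ : _ = aug z) ?subrr //.
rewrite /aug (bigD1 v) /= ?dim_v // yE eqxx mul1r big1 ?addr0 // => t /andP[_ tv].
by rewrite yE (negPf tv) mul0r.
Qed.

End BoxEmbedding.

(** * Translation by one pixel, that is, by two elementary intervals *)

Section Shift.
Variables (d : nat) (w w' : 'I_d -> nat).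
Hypothesis w'E : forall i, w' i = (w i + 4)%N.

Lemma shift_subproof (s : cube w) i : ((s i).+2 < w' i)%N.
Proof. by rewrite w'E; have := ltn_ord (s i); lia. Qed.

Definition shift (s : cube w) : cube w' := [ffun i => Ordinal (shift_subproof s i)].

Lemma val_shift s i : shift s i = (s i).+2 :> nat.
Proof. by rewrite ffunE. Qed.

Lemma shift_inj : injective shift.
Proof.
move=> s t st; apply: eq_cube => i.
by have /(congr1 (fun u : cube w' => u i : nat)) := st; rewrite !val_shift => -[].
Qed.

Lemma shift_dim s : cube_dim (shift s) = cube_dim s.
Proof. by rewrite !cube_dimE; apply: eq_bigr => i _; rewrite val_shift /= negbK. Qed.

Lemma elem_faceSS a b : elem_face a.+2 b.+2 = elem_face a b.
Proof. by rewrite /elem_face /= negbK !eqSS. Qed.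

Lemma shift_face s t : cube_face (shift s) (shift t) = cube_face s t.
Proof. by apply: eq_forallb => i; rewrite !val_shift elem_faceSS. Qed.

Lemma shift_im (t : cube w') : (forall i, 2 <= t i < (w i).+2)%N ->
  exists s, t = shift s.
Proof.
move=> t_in; have t_lt i : (t i - 2 < w i)%N by have := t_in i; lia.
exists [ffun i => Ordinal (t_lt i)]; apply: eq_cube => i.
by rewrite val_shift ffunE /=; have := t_in i; lia.
Qed.

(** With [w i] odd the outermost intervals are vertices, so both ends of any edge stay inside the
    shifted box. *)
Lemma shift_closed s t : (forall i, odd (w i)) ->
  cube_face s (shift t) -> exists s', s = shift s'.
Proof.
move=> w_odd /forallP st; apply: shift_im => i.
have := st i; rewrite val_shift /elem_face /= negbK.
have := ltn_ord (t i); have := w_odd i;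
by move=> wi tw /orP[/eqP|/andP[t_odd /orP[] /eqP]]; lia.
Qed.

End Shift.

(** * Maxima and minima over nonempty sets *)

Section Extrema.
Variables (R : realType) (S : finType) (P : pred S) (F : S -> R).

(** The witness [x] rules out the default value 0. The fold starts from a member of [P], so the
    maximum is attained there. *)
Lemma max_overP x : P x ->
  (exists2 y, P y & max_over P F = F y) /\ (forall y, P y -> F y <= max_over P F).
Proof.
rewrite /max_over => Px; case: pickP => [x0 Px0|/(_ x)]; last by rewrite Px.
split=> [|y Py]; last exact: le_bigmax_cond.
elim/big_ind: _ => [|a b [y Py ->] [z Pz ->]|y Py]; [by exists x0| |by exists y].
by rewrite /Num.max; case: ifP => _; [exists z|exists y].
Qed.

Lemma min_overP x : P x ->
  (exists2 y, P y & min_over P F = F y) /\ (forall y, P y -> min_over P F <= F y).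
Proof.
rewrite /min_over => Px; case: pickP => [x0 Px0|/(_ x)]; last by rewrite Px.
split=> [|y Py]; last exact: bigmin_le_cond.
elim/big_ind: _ => [|a b [y Py ->] [z Pz ->]|y Py]; [by exists x0| |by exists y].
by rewrite /Num.min; case: ifP => _; [exists y|exists z].
Qed.

End Extrema.

(** * Padding and capping *)

Section Padding.
Variables (R : realType) (d : nat) (n : 'I_d -> nat) (I : digital_image R n) (N : R).
Hypothesis n_gt0 : forall i, (0 < n i)%N.
Hypothesis ltN : forall p, I p < N.
Implicit Types m : 'I_d -> nat.
Local Notation IP := (pad N I).

Lemma pad_in (q : grid n) (p : grid (padded_size n)) :
  (forall i, (q i).+1 = p i :> nat) -> IP p = I q.
Proof.
move=> qp; rewrite /pad; case: pickP => [q' /forallP q'p|/(_ q) /forallP[] i].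
  congr I; apply/ffunP => i; apply: val_inj => /=; apply: succn_inj.
  by rewrite qp (eqP (q'p i)).
by rewrite qp.
Qed.

Lemma pad_ltN p : IP p < N -> exists q : grid n, forall i, (q i).+1 = p i :> nat.
Proof.
rewrite /pad; case: pickP => [q /forallP qp _|]; last by rewrite ltxx.
by exists q => i; apply/eqP.
Qed.

Lemma pad_le p : IP p <= N.
Proof. by rewrite /pad; case: pickP => [q _|_] //; apply/ltW/ltN. Qed.

Lemma up_subproof (q : grid n) i : ((q i).+1 < padded_size n i)%N.
Proof. by rewrite ltnS ltnW // ltnS. Qed.

Definition up (q : grid n) : grid (padded_size n) :=
  [ffun i => Ordinal (up_subproof q i)].

Lemma pad_up q : IP (up q) = I q.
Proof. by apply: pad_in => i; rewrite ffunE. Qed.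

Definition vertex_of m (s : cube (V_width m)) : pred (grid m) :=
  [pred p : grid m | [forall i, elem_face (p i).*2 (s i)]].

Definition coface_of m (s : cube (T_width m)) : pred (grid m) :=
  [pred p : grid m | [forall i, elem_face (s i) (p i).*2.+1]].

Lemma V_vertex m (s : cube (V_width m)) (h : nat -> nat) :
  (forall i, h (s i) < m i)%N ->
  (forall i, elem_face (h (s i)).*2 (s i)) ->
  exists2 p : grid m, vertex_of s p & forall i, p i = h (s i) :> nat.
Proof.
move=> h_lt h_face.
exists [ffun i => Ordinal (h_lt i)] => [|i]; last by rewrite ffunE.
by apply/forallP => i; rewrite ffunE; apply: h_face.
Qed.

(** The lowest vertex of the cube: halving sends an edge to its left end. It also shows that the
    maximum in [V_val] is over a nonempty set. *)
Lemma V_vertex_down m (s : cube (V_width m)) :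
  exists2 p : grid m, vertex_of s p & forall i, p i = (s i)./2 :> nat.
Proof.
apply: (V_vertex (h := half)) => i; have := ltn_ord (s i); rewrite /V_width.
  by lia.
by rewrite /elem_face; lia.
Qed.

Lemma V_vertex_up m (s : cube (V_width m)) :
  exists2 p : grid m, vertex_of s p & forall i, p i = uphalf (s i) :> nat.
Proof.
apply: (V_vertex (h := uphalf)) => i; have := ltn_ord (s i); rewrite /V_width.
  by lia.
by rewrite /elem_face; lia.
Qed.

Lemma V_val_ge m (J : digital_image R m) (s : cube (V_width m)) (p : grid m) :
  (forall i, elem_face (p i).*2 (s i)) -> J p <= V_val J s.
Proof.
move=> /forallP ps; rewrite /V_val.
by have [_ ->] := @max_overP R _ (vertex_of s) J p ps.
Qed.

Lemma V_val_attained m (J : digital_image R m) (s : cube (V_width m)) :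
  exists2 p : grid m, forall i, elem_face (p i).*2 (s i) & V_val J s = J p.
Proof.
have [p0 ps0 _] := V_vertex_down s.
rewrite /V_val.
have [[p /forallP ps ->] _] := @max_overP R _ (vertex_of s) J p0 ps0.
by exists p.
Qed.

Lemma V_val_le m (J : digital_image R m) (M : R) (s : cube (V_width m)) :
  (forall p, J p <= M) -> V_val J s <= M.
Proof. by move=> JM; have [p _ ->] := V_val_attained J s. Qed.

Lemma T_pixel m (s : cube (T_width m)) : (forall i, 0 < m i)%N ->
  exists p : grid m, forall i, elem_face (s i) (p i).*2.+1.
Proof.
(* A vertex is a face of the edge on its right, except for the last vertex, where the minimum
   selects the edge on its left. *)
move=> m_gt0; have h_lt i : (minn (s i)./2 (m i).-1 < m i)%N.
  by have := m_gt0 i; lia.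
exists [ffun i => Ordinal (h_lt i)] => i; rewrite ffunE /elem_face /=.
by have := ltn_ord (s i); rewrite /T_width; have := m_gt0 i; lia.
Qed.

Lemma T_val_le m (J : digital_image R m) (s : cube (T_width m)) (p : grid m) :
  (forall i, elem_face (s i) (p i).*2.+1) -> T_val J s <= J p.
Proof.
move=> /forallP ps; rewrite /T_val.
by have [_ ->] := @min_overP R _ (coface_of s) J p ps.
Qed.

Lemma T_val_attained m (J : digital_image R m) (s : cube (T_width m)) :
  (forall i, 0 < m i)%N ->
  exists2 p : grid m, forall i, elem_face (s i) (p i).*2.+1 & T_val J s = J p.
Proof.
move=> /(T_pixel s)[p0 /forallP ps0].
rewrite /T_val.
have [[p /forallP ps ->] _] := @min_overP R _ (coface_of s) J p0 ps0.
by exists p.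
Qed.

Lemma V_widthP i : V_width (padded_size n) i = (V_width n i + 4)%N.
Proof. by rewrite /V_width /padded_size; have := n_gt0 i; lia. Qed.

Lemma T_widthP i : T_width (padded_size n) i = (T_width n i + 4)%N.
Proof. by rewrite /T_width /padded_size; lia. Qed.

Lemma V_width_odd m i : (0 < m i)%N -> odd (V_width (d := d) m i).
Proof. by rewrite /V_width; lia. Qed.

Lemma T_width_odd m i : odd (T_width (d := d) m i).
Proof. by rewrite /T_width /= odd_double. Qed.

Lemma Dgm_deg_V_pad k : Dgm_deg (V IP) k = Dgm_deg (V I) k.
Proof.
symmetry; apply: (@Dgm_deg_box_embedding R d _ _ _ _ (shift V_widthP) N).
- by move=> i; apply: V_width_odd.
- by move=> i; apply: V_width_odd.
- exact: shift_inj.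
- exact: shift_dim.
- exact: shift_face.
- by move=> s t; apply: shift_closed => i; apply: V_width_odd.
- move=> s; apply/le_anti/andP; split.
    have [p ps ->] := V_val_attained IP (shift V_widthP s).
    (* Vertices of a shifted cube avoid the padding, so undoing the unit shift lands in the original
       grid. *)
    have q_lt i : ((p i).-1 < n i)%N.
      have := ps i; rewrite val_shift; have := ltn_ord (s i).
      by rewrite /elem_face /V_width; lia.
    have qp i : (Ordinal (q_lt i)).+1 = p i :> nat.
      by have := ps i; rewrite val_shift /elem_face /=; lia.
    rewrite (@pad_in [ffun i => Ordinal (q_lt i)]) => [|i]; last by rewrite ffunE.
    apply: V_val_ge => i; rewrite ffunE -elem_faceSS -doubleS qp -(val_shift V_widthP).
    exact: ps.
  have [q qs ->] := V_val_attained I s.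
  rewrite -pad_up; apply: V_val_ge => i.
  by rewrite ffunE val_shift /= doubleS elem_faceSS.
(* A maximum below [N] excludes padding vertices. Applied to the lowest and the highest vertex, this
   confines the cube to the shifted box. *)
- move=> t tN; apply: shift_im => i.
  have vertex (p : grid (padded_size n)) : vertex_of t p ->
      exists q : grid n, forall i, (q i).+1 = p i :> nat.
    by move=> /forallP pt; apply: pad_ltN; apply: le_lt_trans tN; apply: V_val_ge.
  have [p pt pE] := V_vertex_down t; have [q qp] := vertex p pt.
  have [p' pt' pE'] := V_vertex_up t; have [q' qp'] := vertex p' pt'.
  have := qp i; have := qp' i; rewrite pE pE'; have := ltn_ord (q' i).
  by rewrite /V_width; lia.
- by move=> s; apply: V_val_le => p; apply/ltW/ltN.
- by move=> s; apply/V_val_le/pad_le.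
Qed.

Lemma Dgm_deg_T_pad k : Dgm_deg (T IP) k = Dgm_deg (T I) k.
Proof.
symmetry; apply: (@Dgm_deg_box_embedding R d _ _ _ _ (shift T_widthP) N).
- by move=> i; apply: T_width_odd.
- by move=> i; apply: T_width_odd.
- exact: shift_inj.
- exact: shift_dim.
- exact: shift_face.
- by move=> s t; apply: shift_closed => i; apply: T_width_odd.
- move=> s; apply/le_anti/andP; split.
    have [q qs ->] := T_val_attained I s n_gt0.
    rewrite -pad_up; apply: T_val_le => i.
    by rewrite val_shift ffunE /= doubleS elem_faceSS.
  have [q qs sq] := T_val_attained I s n_gt0.
  have [//|p ps ->] := T_val_attained IP (shift T_widthP s).
  (* A shifted cube may be a face of padding cubes, but their value [N] exceeds every pixel and
     cannot lower the minimum. *)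
  have [Np|/pad_ltN[q' q'p]] := leP N (IP p).
    by rewrite sq (le_trans (ltW (ltN q))).
  rewrite (pad_in q'p); apply: T_val_le => i.
  by have := ps i; rewrite val_shift -q'p doubleS elem_faceSS.
(* A minimum below [N] is attained at an image pixel, and all faces of its cube lie in the shifted
   box. *)
- move=> t; have [//|p pt ->] := T_val_attained IP t.
  move=> /pad_ltN[q qp]; apply: shift_im => i.
  have := pt i; rewrite -qp; have := ltn_ord (q i).
  by rewrite /elem_face /T_width; lia.
- by move=> s; have [p _ ->] := T_val_attained I s n_gt0; apply/ltW/ltN.
- by move=> s; have [//|p _ ->] := T_val_attained IP s; apply: pad_le.
Qed.

End Padding.

(** Counts the neighbours of [a] in a segment modulo 2: two inside, one at either end. With [n]
    equal to 1 the ends would coincide and have no neighbour. *)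
Lemma end_parity (n a : nat) : (1 < n)%N -> (a < n)%N ->
  ((a.+1 < n) + (0 < a) = (a == 0) || (a == n.-1) %[mod 2])%N.
Proof.
move=> n_gt1 an; case: (posnP a) => [->|a_gt0].
  by case: n n_gt1 an => [|[]].
by case: (ltngtP a.+1 n) an => // an _; case: eqP => //; lia.
Qed.

(** * Homology of a box with a cap attached *)

Section Cap.
Variables (R : realType) (d : nat) (w : 'I_d -> nat) (f : cube w -> R) (N : R).
Hypothesis d_gt0 : (0 < d)%N.
Hypothesis w_odd : forall i, odd (w i).
Hypothesis w_gt1 : forall i, (1 < w i)%N.
Hypothesis f_le : forall s, f s <= N.
Local Notation X := (cubical f).
Local Notation Y := (cap N f).

Definition top_chain : chain X := [ffun s => (cube_dim s == d)%:R].

(** A cube of dimension [d - 1] has a single vertex coordinate, and its cofaces are its neighbours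
    in that direction: two inside the box, one on the boundary. *)
Lemma bd_top_chain s :
  bd top_chain s = (on_boundary s && (d == (cube_dim s).+1))%:R :> 'F_2.
Proof.
have -> : bd top_chain s =
    \sum_i \sum_(a < w i) (incident (s i) a)%:R * (d == (cube_dim s).+1)%:R :> 'F_2.
  rewrite bd_op sum_ffunE; apply: eq_bigr => i _; rewrite ffunE.
  apply: eq_bigr => a _; rewrite mxE ffunE.
  have := cube_dim_upd s a; rewrite /incident.
  case: (odd (s i)) (odd a) => -[] /=; rewrite ?mul0r // addn0 addn1 => ->.
  by rewrite [d == _]eq_sym.
have [ds|_] := eqVneq d (cube_dim s).+1; last first.
  by rewrite andbF big1 // => i _; rewrite big1 // => a _; rewrite mulr0.
under eq_bigr do under eq_bigr do rewrite -[1]/((fun=> 1) 0%N).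
have : #|[set i : 'I_d | ~~ odd (s i)]| = 1%N.
  have := cardsC [set i : 'I_d | odd (s i)]; rewrite card_ord.
  rewrite (_ : ~: _ = [set i : 'I_d | ~~ odd (s i)]); last first.
    by apply/setP => i; rewrite !inE.
  by move=> AB; apply: (@addnI (cube_dim s)); rewrite addn1 -ds.
move=> /eqP/cards1P[i iE]; have s_odd j : odd (s j) = (j != i).
  by have /setP/(_ j) := iE; rewrite !inE => <-; rewrite negbK.
rewrite (bigD1 i) //= [X in _ + X]big1 ?addr0 => [|j ji]; last first.
  by rewrite big1 // => a _; rewrite /incident s_odd ji mul0r.
rewrite (incident_row (fun=> 1) (ltn_ord (s i))) s_odd eqxx andbT mul1r !mulr1.
(* Only direction [i] can place [s] on the boundary: elsewhere its coordinate is odd, whereas both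
   end positions are even. *)
have -> : on_boundary s = (s i == 0%N :> nat) || (s i == (w i).-1 :> nat).
  apply/existsP/idP => [[j]|]; last by exists i.
  have [->|ji] // := eqVneq j i; have := s_odd j; rewrite ji.
  have even_pred m : odd m -> odd m.-1 = false by case: m => //= m /negPf.
  by move=> sj /orP[] /eqP sE; move: sj; rewrite sE // even_pred.
rewrite -natrD; apply: val_inj; rewrite /= !val_Fp_nat //.
exact: end_parity (w_gt1 i) (ltn_ord (s i)).
Qed.

Local Notation incl := (Some : cell X -> cell Y).

(** The fundamental cycle modulo 2 of the sphere formed by the box and its cap. *)
Definition sphere_chain : chain Y := [ffun t => (cdim t == d)%:R].

Let some_inj : injective incl.
Proof. by move=> s t []. Qed.

Let some_dim (s : cell X) : cdim (Some s : cell Y) = cdim s.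
Proof. by []. Qed.

Let some_face (s t : cell X) : face (Some s : cell Y) (Some t) = face s t.
Proof. by []. Qed.

Let some_closed (s : cell Y) (t : cell X) : face s (Some t : cell Y) ->
  exists s' : cell X, s = Some s'.
Proof. by case: s => // s _; exists s. Qed.

Let some_val (s : cell X) : fval (Some s : cell Y) = fval s.
Proof. by []. Qed.

Lemma bd_cap_Some (c : chain Y) (c' : chain X) (s : cell X) :
  (forall t, c (Some t) = c' t) ->
  bd c (Some s) =
    bd c' s + (on_boundary s && (d == (cube_dim s).+1))%:R * c None :> 'F_2.
Proof.
move=> cc'; rewrite !ffunE big_mkcond (bigD1 None) //= addrC; congr (_ + _).
  rewrite (reindex_omap Some id) => [|[]] //=.
  rewrite [RHS]big_mkcond; apply: eq_big => [t|t _]; first by rewrite eqxx.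
  by rewrite cc'.
by case: (_ && _); rewrite ?mul1r ?mul0r.
Qed.

Lemma bd_cap_None (c : chain Y) : bd c None = 0.
Proof.
rewrite ffunE big1 // => -[s //|]; rewrite /= => /eqP dd.
by have := ltnn d; rewrite {2}dd leqnn.
Qed.

(** On each boundary face of dimension [d - 1] the cap and the one adjacent cube cancel. *)
Lemma sphere_cycle r : N <= r -> sphere_chain \in cycles d (sublevel Y r).
Proof.
move=> Nr; apply/mem_cyclesP; split.
  apply/mem_chainsP => t; rewrite !inE ffunE; case: (cdim t =P d) => [td _|_];
    last by rewrite eqxx.
  by split=> //; case: t {td} => [t|] //=; apply: le_trans Nr.
apply/ffunP => -[s|]; last by rewrite bd_cap_None ffunE.
rewrite (@bd_cap_Some _ top_chain) => [|t]; last by rewrite !ffunE.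
by rewrite bd_top_chain [sphere_chain _]ffunE eqxx mulr1 addF2 ffunE.
Qed.

Lemma cap_cycle_Some k r z : z \in cycles k (sublevel Y r) -> z None = 0 ->
  exists2 y, y \in cycles k (sublevel X r) & z = push incl y.
Proof.
move=> zY zN; pose y : chain X := [ffun s => z (Some s) : ('F_2)^o].
have zE : z = push incl y.
  by apply: (push_restrict some_inj) => -[t|]; [exists t | rewrite zN eqxx].
exists y => //; apply/(push_cycles some_inj some_dim some_face some_closed some_val).
by rewrite -zE.
Qed.

Lemma cap_top_cycle0 r z : z \in cycles d (sublevel Y r) -> z None = 0 -> z = 0.
Proof.
move=> /cap_cycle_Some zY /zY[y yX ->].
rewrite [y](@top_cycle0 R d w f w_odd) ?linear0 //.
exact: (subvP (cyclesS d (subsetT _))) yX.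
Qed.

(** A nonzero coefficient on the cap is 1 and forces the level to reach [N]. Subtracting
    [sphere_chain] then leaves a [d]-cycle of the box, which is 0. *)
Lemma cap_cycle r z : z \in cycles d (sublevel Y r) ->
  z = 0 \/ N <= r /\ z = sphere_chain.
Proof.
move=> zY; have [zN|zN] := eqVneq (z None : 'F_2) 0.
  by left; apply: cap_top_cycle0 zY zN.
have Nr : N <= r.
  by have /mem_cyclesP[/mem_chainsP/(_ None zN)[]] := zY; rewrite inE.
right; split=> //; apply/eqP; rewrite -subr_eq0; apply/eqP/(@cap_top_cycle0 r).
  exact: memvB zY (sphere_cycle Nr).
by rewrite !ffunE eqxx (F2_neq0 zN) subrr.
Qed.

Lemma cap_boundary0 r z : z \in boundaries d (sublevel Y r) -> z = 0.
Proof.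
move=> /mem_boundariesP[b /mem_chainsP bY ->]; suff -> : b = 0 by rewrite linear0.
apply/ffunP => t; rewrite [RHS]ffunE; apply/eqP; apply: contraT => /bY[_].
by case: t => [s|] /= => [dimE|/n_Sn //]; have := cube_dim_le s; rewrite dimE ltnn.
Qed.

Lemma Dgm_deg_box_top : Dgm_deg X d = mset0.
Proof. by apply: Dgm_deg_no_cycle => z; apply: top_cycle0. Qed.

Lemma Dgm_deg_cap_top : Dgm_deg Y d = [mset (N, +oo%E)].
Proof.
pose g r : homology d (sublevel Y r) :=
  vpi (bd_in_cycles d (sublevel Y r))
    (vsproj (cycles d (sublevel Y r)) sphere_chain).
apply: (@barcode_ray R (pers_homology Y d) N g)
  => [r x rN|r Nr|r x Nr|r s rs Nr].
- rewrite -[x]vpi_repr; suff -> : repr x = 0 by rewrite linear0.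
  apply: val_inj; have [//|[Nr _]] := cap_cycle (subvsP (repr x)).
  by move: rN; rewrite ltNge Nr.
- apply/eqP => g0; have : vpi (bd_in_cycles d (sublevel Y r))
     (vsproj (cycles d (sublevel Y r)) sphere_chain) ==
     vpi (bd_in_cycles d (sublevel Y r)) 0.
    by rewrite linear0; apply/eqP.
  rewrite vpi_eq subr0 mem_bd_in_cycles vsprojK ?sphere_cycle //.
  move=> /cap_boundary0/ffunP/(_ None); rewrite !ffunE eqxx => /eqP.
  by rewrite oner_eq0.
- rewrite -[x]vpi_repr; have [x0|[_ xE]] := cap_cycle (subvsP (repr x)).
    by left; rewrite [repr x](_ : _ = 0) ?linear0 //; apply: val_inj.
  by right; rewrite /g -xE vsvalK.
rewrite /g /= homology_mapE ?sublevelS //; congr vpi; apply: val_inj.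
apply: (etrans (cycle_inclE (X := Y) _ (sublevelS Y rs))).
rewrite vsprojK ?sphere_cycle //; apply: esym.
by apply: vsprojK; apply/sphere_cycle/(le_trans Nr).
Qed.

(** Below degree [d] no cycle involves the cap, which gives surjectivity. For injectivity, a
    bounding chain that uses the cap is moved into the box. *)
Lemma Dgm_deg_cap k : (k < d)%N -> Dgm_deg X k = Dgm_deg Y k.
Proof.
move=> kd.
apply: (@Dgm_deg_embedding R X Y incl some_inj some_dim some_face some_closed
  some_val k N) => [[t _|]|r y b Nr /mem_cyclesP[yc _] bY yb|r z Nr zY].
- by exists t.
- by rewrite /= ltxx.
- have b_dim : b None != 0 -> d = k.+1 by move=> /(mem_chainsP _ _ _ bY)[].
  pose b' : chain X := [ffun s => b (Some s) : ('F_2)^o].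
  (* The cap is traded for [top_chain], which has the same boundary. This happens only when [d] is
     [k.+1], so the degree is right. *)
  apply/mem_boundariesP; exists (b' + (b None : 'F_2) *: top_chain).
    apply/mem_chainsP => s; rewrite !ffunE inE (le_trans (f_le s)) // => bs.
    split=> //.
    apply/eqP; apply: contraNT bs => sk; have [bN|/b_dim dk] := eqVneq (b None) 0.
      rewrite bN scale0r addr0; apply: contraNT sk => /(mem_chainsP _ _ _ bY)[_ <-].
      by rewrite eqxx.
    have -> : (cube_dim s == d) = false.
      by case: eqP => // sd; case/eqP: sk; apply: etrans sd dk.
    rewrite scaler0 addr0.
    by apply: contraNT sk => /(mem_chainsP _ _ _ bY)[_ <-]; rewrite eqxx.
  apply/ffunP => s; rewrite -(push_im some_inj y) yb (@bd_cap_Some _ b') => [|t].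
    rewrite linearD linearZ [RHS]ffunE; congr (_ + _).
    by rewrite [RHS]ffunE bd_top_chain [LHS]mulrC.
  by rewrite ffunE.
have [|y yX zE] := cap_cycle_Some zY.
  have /mem_cyclesP[/mem_chainsP zk _] := zY.
  by apply/eqP; apply: contraTT kd => /zk[_ /= <-]; rewrite ltnn.
by exists y => //; rewrite -zE subrr mem0v.
Qed.

End Cap.

(** * Persistence diagrams *)

Lemma eq_Dgm (R : realType) (X Y : filtered_complex R) m :
  (forall s : cell X, (cdim s <= m)%N) -> (forall s : cell Y, (cdim s <= m)%N) ->
  (forall k, Dgm_deg X k = Dgm_deg Y k) -> Dgm X = Dgm Y.
Proof.
move=> Xm Ym XY; rewrite (Dgm_le_dim Xm) (Dgm_le_dim Ym).
by congr (seq_mset (flatten _)); apply: eq_map => k; rewrite XY.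
Qed.

Lemma Dgm_new_top (R : realType) (X Y : filtered_complex R) m J :
  (forall s : cell X, (cdim s <= m)%N) -> (forall s : cell Y, (cdim s <= m)%N) ->
  (forall k, (k < m)%N -> Dgm_deg X k = Dgm_deg Y k) ->
  Dgm_deg X m = mset0 -> Dgm_deg Y m = [mset J] ->
  Dgm Y = Dgm X `+` [mset (m, J)].
Proof.
move=> Xm Ym XY X0 YJ; rewrite (Dgm_le_dim Xm) (Dgm_le_dim Ym) -addn1 iotaD.
rewrite !allpairs_cat /= X0 YJ enum_mset0 (enum_msetn 1 J) /= !cats0.
have -> : [seq (k, K) | k <- iota 0 m, K <- enum_mset (Dgm_deg Y k)] =
    [seq (k, K) | k <- iota 0 m, K <- enum_mset (Dgm_deg X k)].
  congr flatten; apply/eq_in_map => k; rewrite mem_iota => /andP[_ km].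
  by rewrite XY.
apply/msetP => K; rewrite msetE2 !mset_seqE count_cat /= addn0 msetnE eq_sym.
by case: eqP.
Qed.

Theorem proposition5p1 (R : realType) (d : nat) (n : 'I_d -> nat)
    (I : digital_image R n) (N : R)
    (d_gt0 : (0 < d)%N) (n_gt0 : forall i, (0 < n i)%N)
    (ltN : forall p, (I p < N)%R) :
  (Dgm (V (pad N I)) = Dgm (V I) /\ Dgm (T (pad N I)) = Dgm (T I)) /\
  (Dgm (Vhat N (pad N I)) =
     (Dgm (V (pad N I)) `+` [mset (d, (N, +oo%E))])%mset /\
   Dgm (That N I) = (Dgm (T I) `+` [mset (d, (N, +oo%E))])%mset).
Proof.
have cap_Dgm (w : 'I_d -> nat) (f : cube w -> R) :
    (forall i, odd (w i)) -> (forall i, 1 < w i)%N -> (forall s, f s <= N) ->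
    Dgm (cap N f) = (Dgm (cubical f) `+` [mset (d, (N, +oo%E))])%mset.
  move=> w_odd w_gt1 f_le; apply: Dgm_new_top.
  - by move=> s; apply: cube_dim_le.
  - by case=> [s|]; [apply: cube_dim_le | apply: leqnn].
  - by move=> k; apply: Dgm_deg_cap.
  - exact: Dgm_deg_box_top.
  - exact: Dgm_deg_cap_top.
split; split.
- apply: (@eq_Dgm _ _ _ d); try by move=> s; apply: cube_dim_le.
  by move=> k; apply: Dgm_deg_V_pad.
- apply: (@eq_Dgm _ _ _ d); try by move=> s; apply: cube_dim_le.
  by move=> k; apply: Dgm_deg_T_pad.
(* Padding gives every direction an edge, even where the image is one pixel wide, so the capped box
   is never degenerate. *)
- apply: cap_Dgm => [i|i|s]; first exact: V_width_odd.
    by rewrite /V_width /padded_size.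
  by apply/V_val_le/pad_le.
apply: cap_Dgm => [i|i|s]; first exact: T_width_odd.
  by rewrite /T_width ltnS double_gt0.
by have [p _ ->] := T_val_attained I s n_gt0; apply/ltW/ltN.
Qed.
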